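(* Let $\omega$ be a non-quasianalytic weight function and $1\le p<\infty$. Then: (1) $\mathcal{O}_{M,\omega}(\mathbb{R}^N)=\mathcal{O}_{M,\omega,p}(\mathbb{R}^N)$ algebraically and topologically; (2) $\mathcal{O}_{C,\omega}(\mathbb{R}^N)=\mathcal{O}_{C,\omega,p}(\mathbb{R}^N)$ algebraically and topologically.
   Context: $\mathbb{N}=\{1,2,\dots\}$, $\mathbb{N}_0=\mathbb{N}\cup\{0\}$. A non-quasianalytic weight function is a continuous increasing (i.e. non-decreasing) function $\omega:[0,\infty)\to[0,\infty)$ such that: ($\alpha$) there is $K\ge1$ with $\omega(2t)\le K(1+\omega(t))$ for all $t\ge0$; ($\beta$) $\int_1^\infty\frac{\omega(t)}{1+t^2}\,dt<\infty$; ($\gamma$) there are $a\in\mathbb{R}$, $b>0$ with $\omega(t)\ge a+b\log(1+t)$ for all $t\ge0$; ($\delta$) $\varphi_\omega(t):=\omega(e^t)$ is convex. It is assumed (without loss of generality) that $\omega$ vanishes on $[0,1]$. For $x\in\mathbb{R}^N$, $\omega(x):=\omega(|x|)$. The Young conjugate is $\varphi^*_\omega(s):=\sup_{t\ge0}\{st-\varphi_\omega(t)\}$, $s\ge0$ (with $\exp(-\infty)=0$, $\exp(+\infty)=+\infty$, $0\cdot\infty=0$ if the supremum is $+\infty$). For $m\in\mathbb{N}$, $n\in\mathbb{Z}$, $\mathcal{O}^m_{n,\omega}(\mathbb{R}^N)$ is the space of all $f\in C^\infty(\mathbb{R}^N)$ with $r_{m,n}(f):=\sup_{\alpha\in\mathbb{N}_0^N}\sup_{x\in\mathbb{R}^N}|\partial^\alpha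 f(x)|\exp\left(-n\omega(x)-m\varphi^*_\omega\left(\frac{|\alpha|}{m}\right)\right)<\infty$, normed by $r_{m,n}$. For $1\le p<\infty$, $\mathcal{O}^m_{n,\omega,p}(\mathbb{R}^N)$ is the space of all $f\in C^\infty(\mathbb{R}^N)$ with $r_{m,n,p}(f)^p:=\sum_{\alpha\in\mathbb{N}_0^N}\|\exp(-n\omega)\partial^\alpha f\|_p^p\exp\left(-mp\varphi^*_\omega\left(\frac{|\alpha|}{m}\right)\right)<\infty$, normed by $r_{m,n,p}$. $\mathcal{O}_{M,\omega}(\mathbb{R}^N):=\bigcap_{m=1}^\infty\bigcup_{n=1}^\infty\mathcal{O}^m_{n,\omega}(\mathbb{R}^N)$ with the locally convex topology of $\mathrm{proj}_m\,\mathrm{ind}_n\,\mathcal{O}^m_{n,\omega}(\mathbb{R}^N)$, and $\mathcal{O}_{C,\omega}(\mathbb{R}^N):=\bigcup_{n=1}^\infty\bigcap_{m=1}^\infty\mathcal{O}^m_{n,\omega}(\mathbb{R}^N)$ with the locally convex topology of $\mathrm{ind}_n\,\mathrm{proj}_m\,\mathcal{O}^m_{n,\omega}(\mathbb{R}^N)$. The spaces $\mathcal{O}_{M,\omega,p}(\mathbb{R}^N)$ and $\mathcal{O}_{C,\omega,p}(\mathbb{R}^N)$ are defined in the same way with $\mathcal{O}^m_{n,\omega,p}(\mathbb{R}^N)$ in place of $\mathcal{O}^m_{n,\omega}(\mathbb{R}^N)$. All limits are in the category of locally convex spaces. *)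

(* Defs.v *)
From HB Require Import structures.
From mathcomp Require Import all_boot all_order all_algebra.
From mathcomp Require Import all_classical all_reals all_analysis.
From mathcomp Require Import complex.

Set Implicit Arguments.
Unset Strict Implicit.
Unset Printing Implicit Defensive.

Import Order.TTheory GRing.Theory Num.Def Num.Theory.
Import numFieldNormedType.Exports.

Local Open Scope classical_set_scope.
Local Open Scope ring_scope.

Section LebesgueTuple.
Context {R : realType}.

Definition tuple_cons n (xt : measurableTypeR R * n.-tuple (measurableTypeR R)) :
  n.+1.-tuple (measurableTypeR R) := [the n.+1.-tuple _ of xt.1 :: xt.2].

Lemma measurable_tuple_cons n : measurable_fun [set: _] (@tuple_cons n).
Proof. exact: measurable_cons. Qed.

Section Step.
Variables (n : nat)
  (mu : {sigma_finite_measure set (n.-tuple (measurableTypeR R)) -> \bar R}).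

(* The library has products of two measures but no Lebesgue measure on R^n;
   [lebesgue_tuple] iterates the product, see [lebesgue_tuple_box]. *)
Definition lebesgue_cons : set (n.+1.-tuple (measurableTypeR R)) -> \bar R :=
  pushforward (@lebesgue_measure R \x mu)%E (@tuple_cons n).

Let m0 : lebesgue_cons set0 = 0%E.
Proof. by rewrite /lebesgue_cons /pushforward preimage_set0 measure0. Qed.

Let mge0 A : (0 <= lebesgue_cons A)%E.
Proof. by rewrite /lebesgue_cons /pushforward measure_ge0. Qed.

Let msa : semi_sigma_additive lebesgue_cons.
Proof.
move=> F mF tF mUF; rewrite /lebesgue_cons /pushforward preimage_bigcup.
apply: measure_semi_sigma_additive.
- by move=> i; rewrite -[X in measurable X]setTI; exact: measurable_tuple_cons.
- apply/trivIsetP => /= i j _ _ ij; rewrite -preimage_setI.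
  by move/trivIsetP : tF => /(_ _ _ _ _ ij) ->//; rewrite preimage_set0.
- rewrite -preimage_bigcup -[X in measurable X]setTI.
  exact: measurable_tuple_cons.
Qed.

HB.instance Definition _ := isMeasure.Build _ _ _ lebesgue_cons m0 mge0 msa.

Let msf : sigma_finite setT lebesgue_cons.
Proof.
have /sigma_finiteP[F [FT ndF Ffin]] := sigma_finiteT (@lebesgue_measure R).
have /sigma_finiteP[G [GT ndG Gfin]] := sigma_finiteT mu.
have mH k : measurable
    [set t : n.+1.-tuple (measurableTypeR R) |
      F k (thead t) /\ G k [tuple of behead t]].
  have [mF _] := Ffin k; have [mG _] := Gfin k.
  apply: measurableI; rewrite -[X in measurable X]setTI.
  - exact: (measurable_tnth ord0).
  - exact: measurable_behead.
exists (fun k => [set t : n.+1.-tuple (measurableTypeR R) |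
      F k (thead t) /\ G k [tuple of behead t]]).
  apply/seteqP; split=> // t _.
  have [j _ Fj] : (\bigcup_k F k) (thead t) by rewrite -FT.
  have [k _ Gk] : (\bigcup_k G k) [tuple of behead t] by rewrite -GT.
  exists (maxn j k) => //; split.
  - by move: Fj; exact/subsetPset/ndF/leq_maxl.
  - by move: Gk; exact/subsetPset/ndG/leq_maxr.
move=> k; split; first exact: mH.
have [mF Fk] := Ffin k; have [mG Gk] := Gfin k.
rewrite /lebesgue_cons /pushforward.
rewrite (_ : _ @^-1` _ = F k `*` G k).
  by rewrite product_measure1E// lte_mul_pinfty// ge0_fin_numE.
by apply/seteqP; split=> -[x t] /= [Fx Gt]; split=> //;
  move: Gt; congr (G k _); apply/val_inj.
Qed.

HB.instance Definition _ := Measure_isSigmaFinite.Build _ _ _ lebesgue_cons msf.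

End Step.

Fixpoint lebesgue_tuple (n : nat) :
    {sigma_finite_measure set (n.-tuple (measurableTypeR R)) -> \bar R} :=
  match n with
  | 0 => \d_([tuple] : 0.-tuple (measurableTypeR R))
  | n'.+1 => lebesgue_cons (lebesgue_tuple n')
  end.

Lemma lebesgue_tuple_box n (A : 'I_n -> set (measurableTypeR R)) :
  (forall i, measurable (A i)) ->
  lebesgue_tuple n [set t | forall i, A i (tnth t i)] =
  (\prod_(i < n) lebesgue_measure (A i))%E.
Proof.
elim: n A => [|n IHn] A mA.
  rewrite big_ord0 /= diracE mem_set//=.
  by case.
rewrite big_ord_recl -(IHn (fun i => A (lift ord0 i)))//.
rewrite -product_measure1E//; last first.
  rewrite (_ : [set _ | _] = \bigcap_(i in [set: 'I_n])
      ((fun t : n.-tuple (measurableTypeR R) => tnth t i) @^-1` A (lift ord0 i))).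
    apply: fin_bigcap_measurable => // i _; rewrite -[X in measurable X]setTI.
    exact: measurable_tnth.
  by apply/seteqP; split=> t /= tA i *; exact: tA.
rewrite /= /lebesgue_cons /pushforward; congr (_ _).
apply/seteqP; split=> -[x t] /=.
  move=> xt; split; first exact: (xt ord0).
  by move=> i; have := xt (lift ord0 i); rewrite tnthS.
move=> [Ax At] i; case: (unliftP ord0 i) => [j|] ->; first by rewrite tnthS.
exact: Ax.
Qed.

End LebesgueTuple.

Section Weight.
Context {R : realType}.
Implicit Types (w : R -> R).

(* Only the values of [w] on [0, +oo[ are constrained. *)
Record nonquasianalytic_weight w : Prop := {
  weight_continuous : {within `[0, +oo[, continuous w} ;
  weight_ge0 : forall t : R, 0 <= t -> 0 <= w t ;
  weight_nondecreasing : forall s t : R, 0 <= s -> s <= t -> w s <= w t ;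
  weight_alpha : exists2 K : R, 1 <= K &
    forall t : R, 0 <= t -> w (2 * t) <= K * (1 + w t) ;
  weight_beta :
    (\int[@lebesgue_measure R]_(t in `[1%R, +oo[) (w t / (1 + t ^+ 2))%:E < +oo)%E ;
  weight_gamma : exists a b : R, 0 < b /\
    forall t : R, 0 <= t -> a + b * ln (1 + t) <= w t ;
  weight_delta : convex_function [set: R^o] (fun t => w (expR t)) ;
  weight_eq0 : forall t : R, 0 <= t -> t <= 1 -> w t = 0
}.

Definition young_conjugate w (s : R) : \bar R :=
  ereal_sup [set (s * t - w (expR t))%:E | t in `[0, +oo[].

End Weight.

Section Smooth.
Context {R : realType} {N : nat}.
Implicit Types (f : 'rV[R]_N -> R[i]) (i : 'I_N) (s : seq 'I_N).

(* The library norm on ['rV_N] is the maximum norm. *)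
Definition enorm (x : 'rV[R]_N) : R := Num.sqrt (\sum_i x ord0 i ^+ 2).

Definition modulus (z : R[i]) : R := ComplexField.Normc.normc z.

Definition re_part f : 'rV[R]_N -> R := fun x => complex.Re (f x).
Definition im_part f : 'rV[R]_N -> R := fun x => complex.Im (f x).

(* The library has no normed R-module structure on [R[i]], so that derivatives
   are taken componentwise. *)
Definition partial i f : 'rV[R]_N -> R[i] :=
  fun x => Complex ('D_(delta_mx ord0 i) (re_part f) x)
                   ('D_(delta_mx ord0 i) (im_part f) x).

Definition partials s f : 'rV[R]_N -> R[i] := foldr partial f s.

Definition smooth f : Prop := forall s,
  [/\ continuous (re_part (partials s f)),
      continuous (im_part (partials s f)) &
      forall x i, derivable (re_part (partials s f)) x (delta_mx ord0 i) /\
                  derivable (im_part (partials s f)) x (delta_mx ord0 i)].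

Definition mlength (a : {ffun 'I_N -> nat}) : nat := \sum_i a i.
Definition mpartial (a : {ffun 'I_N -> nat}) f : 'rV[R]_N -> R[i] :=
  partials (flatten [seq nseq (a i) i | i <- enum 'I_N]) f.

End Smooth.

Section Norms.
Context {R : realType} {N : nat}.
Variable w : R -> R.
Implicit Types (m : nat) (n : int) (p : R) (f : 'rV[R]_N -> R[i]).

Definition young_term m (a : {ffun 'I_N -> nat}) : \bar R :=
  (m%:R%:E * young_conjugate w ((mlength a)%:R / m%:R))%E.

Definition rnorm m n f : \bar R :=
  ereal_sup [set ((modulus (mpartial ax.1 f ax.2))%:E *
                  expeR (- (n%:~R * w (enorm ax.2))%:E - young_term m ax.1))%E
            | ax in [set: {ffun 'I_N -> nat} * 'rV[R]_N]].

Definition Lpnorm p (g : 'rV[R]_N -> R) : \bar R :=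
  Lnorm (lebesgue_tuple N) p%:E (fun t => (g (\row_i tnth t i))%:E).

Definition weighted_partial n a f : 'rV[R]_N -> R :=
  fun x => expR (- (n%:~R * w (enorm x))) * modulus (mpartial a f x).

(* The [p]-th power of the norm is a possibly infinite sum of nonnegative terms,
   with the convention [+oo * 0 = 0]. *)
Definition rpnorm m n p f : \bar R :=
  poweR (\esum_(a in [set: {ffun 'I_N -> nat}])
     (poweR (Lpnorm p (weighted_partial n a f)) p *
      expeR (- (p%:E * young_term m a))))%E p^-1.

End Norms.

Section Limits.
Context {K : numFieldType} {E : lmodType K}.
Implicit Types (X U V : set E) (tau : set (set E)).

(* All spaces are subspaces of one ambient vector space [E] and inherit its linear
   structure, so that two of them agree algebraically and topologically when their
   carriers and their families of open sets are equal. *)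
Record topsub := Topsub { carrier : set E ; opens : set (set E) }.

Definition topology_on X tau : Prop :=
  [/\ forall U, tau U -> U `<=` X, tau X, setI_closed tau &
      forall F : set (set E), F `<=` tau -> tau (\bigcup_(U in F) U)].

Record lc_topology X tau : Prop := {
  lc_topology_on : topology_on X tau ;
  lc_add : forall x y U, X x -> X y -> tau U -> U (x + y) ->
    exists V W, [/\ tau V, tau W, V x, W y &
      forall v z, V v -> W z -> U (v + z)] ;
  lc_scale : forall (a : K) x U, X x -> tau U -> U (a *: x) ->
    exists e V, [/\ 0 < e, tau V, V x &
      forall b v, `|b - a| < e -> V v -> U (b *: v)] ;
  lc_convex : forall x U, tau U -> U x ->
    exists V, [/\ tau V, V x, V `<=` U & convex_set (V : set (convex_lmodType E))]
}.

(* Coarsest topology on the intersection that makes all inclusions continuous. *)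
Definition proj_lim (I : Type) (X : I -> topsub) : topsub :=
  let P := \bigcap_i carrier (X i) in
  Topsub P (smallest (topology_on P)
    [set U | exists i V, opens (X i) V /\ U = V `&` P]).

(* Finest locally convex topology on the union that makes all inclusions
   continuous; a supremum of locally convex topologies is locally convex. *)
Definition ind_lim (I : Type) (X : I -> topsub) : topsub :=
  let P := \bigcup_i carrier (X i) in
  Topsub P (smallest (topology_on P)
    [set U | exists tau, [/\ lc_topology P tau,
       forall i V, tau V -> opens (X i) (V `&` carrier (X i)) & tau U]]).

Definition normed_sub (R : realType) (X : set E) (r : E -> \bar R) : topsub :=
  Topsub X [set U | U `<=` X /\
    forall f, U f -> exists2 e : R, 0 < e &
      forall g, X g -> (r (g - f)%R < e%:E)%E -> U g].

End Limits.

Section Spaces.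
Context {R : realType}.
Variables (N : nat) (w : R -> R).

Local Notation fspace := ('rV[R]_N -> R[i]).

Definition Omn (m : nat) (n : int) : @topsub R[i] fspace :=
  normed_sub [set f : fspace | smooth f /\ (rnorm w m n f < +oo)%E] (rnorm w m n).

Definition Omnp (p : R) (m : nat) (n : int) : @topsub R[i] fspace :=
  normed_sub [set f : fspace | smooth f /\ (rpnorm w m n p f < +oo)%E]
    (rpnorm w m n p).

(* Both indices range over the positive integers, hence the successors. *)
Definition O_M : @topsub R[i] fspace :=
  proj_lim (fun m : nat => ind_lim (fun n : nat => Omn m.+1 (Posz n.+1))).

Definition O_C : @topsub R[i] fspace :=
  ind_lim (fun n : nat => proj_lim (fun m : nat => Omn m.+1 (Posz n.+1))).

Definition O_Mp (p : R) : @topsub R[i] fspace :=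
  proj_lim (fun m : nat => ind_lim (fun n : nat => Omnp p m.+1 (Posz n.+1))).

Definition O_Cp (p : R) : @topsub R[i] fspace :=
  ind_lim (fun n : nat => proj_lim (fun m : nat => Omnp p m.+1 (Posz n.+1))).

End Spaces.

(* Main.v *)
(* In both directions the inclusion follows from a norm estimate that loses a
   little in the indices; [Y_m a] abbreviates [m phi^*(|a| / m)].

   From the sup norms to the L^p norms: (alpha) gives
   [Y_(m K) a <= Y_m a - |a| ln 2 + c], and the factors [2^-|a|] are summable over
   the multi-indices, while (gamma) makes [exp (- k w)] integrable for large [k].

   From the L^p norms to the sup norms: on the unit cube [x + [0,1]^N],
   [|g x| <= \sum_(b in {0,1}^N) \int |D^b g|], the values of [w] on the cube are
   controlled by [K w x + c] because of (alpha), and (gamma) absorbs the at most [N]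
   extra derivatives: [Y_(m + q) (a + b) <= Y_m a + c].

   The change of [n] never depends on [m], so the inclusions are continuous
   between the inductive limits of projective limits as well as between the
   projective limits of inductive limits. *)
Require Import Defs.
From HB Require Import structures.
From mathcomp Require Import all_boot all_order all_algebra.
From mathcomp Require Import all_classical all_reals all_analysis.
From mathcomp Require Import complex.
From mathcomp Require Import measurable_realfun ring lra.

Set Implicit Arguments.
Unset Strict Implicit.
Unset Printing Implicit Defensive.

Import Order.TTheory GRing.Theory Num.Theory.
Import numFieldNormedType.Exports.

Local Open Scope classical_set_scope.
Local Open Scope ring_scope.

(** * Mixed partial derivatives *)

Section Lines.
Context {R : realType} {V : normedModType R}.
Implicit Types (u : V -> R) (y a b v : V) (s : R).

(** Three obstacles shape the details. [mpartial] differentiates in one fixed order, whereas the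
    cube estimate adds first-order derivatives to an arbitrary multi-index; symmetry of mixed
    derivatives is therefore proved first, from the existence and continuity of iterated partials.
    Next, [young_term] may be +oo, for instance when [w] grows only logarithmically; such an index
    carries the weight exp (-oo) = 0, so the inequalities between Young terms assume that the
    right-hand one is finite. Finally, continuity of an inclusion between two inductive limits
    amounts to restricting locally convex topologies to the smaller union, which should then be
    linear. For [O_M] linearity is checked at each level [m]; for [O_C] the two unions are seen to
    coincide beforehand. *)

Lemma line_quotient u y v s :
  (fun h : R => h^-1 *: (((fun r : R => u (y + r *: v)) \o shift s) (h *: 1) -
    u (y + s *: v))) =
  (fun h : R => h^-1 *: ((u \o shift (y + s *: v)) (h *: v) - u (y + s *: v))).
Proof.
apply/funext => h; rewrite /= [h *: _]mulr1.
by congr (_ *: (u _ - _)); rewrite scalerDl addrCA.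
Qed.

Lemma is_derive_line u y v s : derivable u (y + s *: v) v ->
  is_derive s 1 (fun r : R => u (y + r *: v)) ('D_v u (y + s *: v)).
Proof.
by move=> du; split; rewrite /derivable /derive line_quotient.
Qed.

Lemma continuous_line u y v : continuous u ->
  continuous (fun r : R => u (y + r *: v)).
Proof.
move=> cu s; apply: (@continuous_comp _ _ _ (fun r : R => y + r *: v) u);
  last exact: cu.
apply: cvgD; first exact: cvg_cst.
apply: cvgZr_tmp; exact: cvg_id.
Qed.

(** Mean value theorem twice: along [a] for the difference [phi] of [u] on two parallel lines, then
    along [b] for ['D_a u]. The second difference on the left is symmetric in [a] and [b], the
    right-hand side is not; [schwarz] exploits this. *)
Lemma mixed_difference u a b x (h : R) : 0 < h ->
  (forall y, derivable u y a) -> (forall y, derivable ('D_a u) y b) ->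
  exists s t : R, [/\ 0 < s < h, 0 < t < h &
    u (x + h *: a + h *: b) - u (x + h *: a) - u (x + h *: b) + u x =
    'D_b ('D_a u) (x + s *: a + t *: b) * h ^+ 2].
Proof.
move=> h0 da dba.
pose phi r := u (x + h *: b + r *: a) - u (x + r *: a).
have dphi (r : R) : is_derive r 1 phi
    ('D_a u (x + h *: b + r *: a) - 'D_a u (x + r *: a)).
  by apply: is_deriveB; exact: is_derive_line.
have [|s sh phiE] := @MVT _ phi _ 0 h h0 (fun r _ => dphi r).
  by apply: derivable_within_continuous => r _; have [] := dphi r.
pose psi r := 'D_a u (x + s *: a + r *: b).
have dpsi (r : R) : is_derive r 1 psi ('D_b ('D_a u) (x + s *: a + r *: b)).
  exact: is_derive_line.
have [|t th psiE] := @MVT _ psi _ 0 h h0 (fun r _ => dpsi r).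
  by apply: derivable_within_continuous => r _; have [] := dpsi r.
exists s, t; split; [by move: sh; rewrite in_itv|by move: th; rewrite in_itv|].
move: phiE psiE; rewrite /phi /psi !scale0r !addr0 !subr0 => phiE psiE.
rewrite (addrAC x (h *: b) (s *: a)) psiE in phiE.
rewrite expr2 mulrA -phiE (addrAC x (h *: a)).
by ring.
Qed.

Lemma schwarz u a b x :
  (forall y, derivable u y a) -> (forall y, derivable u y b) ->
  (forall y, derivable ('D_a u) y b) -> (forall y, derivable ('D_b u) y a) ->
  {for x, continuous ('D_b ('D_a u))} -> {for x, continuous ('D_a ('D_b u))} ->
  'D_b ('D_a u) x = 'D_a ('D_b u) x.
Proof.
move=> da db dab dba cab cba; apply/eqP; rewrite -subr_eq0 -normr_le0.
apply/ler_addgt0Pl => e e0; rewrite addr0.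
have e2 : 0 < e / 2 by rewrite divr_gt0.
have /cvgrPdist_lt/(_ _ e2) := cab; have /cvgrPdist_lt/(_ _ e2) := cba.
move=> /nbhs_ballP[d1 /= d10 B1] /nbhs_ballP[d2 /= d20 B2].
pose d := Num.min d1 d2.
have d0 : 0 < d by rewrite lt_min d10.
(* With this [h], every point x + s a + t b with 0 < s, t < h lies within [d] of [x]; the summand 1
   keeps the denominator positive. *)
pose h := d / (`|a| + `|b| + 1).
have n0 : 0 < `|a| + `|b| + 1 by rewrite ltr_wpDl.
have h0 : 0 < h by rewrite divr_gt0.
have near_x s t : 0 < s < h -> 0 < t < h -> `|x - (x + s *: a + t *: b)| < d.
  move=> /andP[s0 sh] /andP[t0 th].
  rewrite -addrA opprD addrA subrr add0r normrN.
  rewrite (le_lt_trans (ler_normD _ _))// !normrZ !gtr0_norm//.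
  rewrite (@le_lt_trans _ _ (h * (`|a| + `|b|)))//.
    by rewrite mulrDr lerD// ler_wpM2r// ltW.
  by rewrite /h mulrAC ltr_pdivrMr// ltr_pM2l// ltrDl.
have near' s t : 0 < s < h -> 0 < t < h -> `|x - (x + s *: b + t *: a)| < d.
  by move=> sh th; have := near_x t s th sh; rewrite (addrAC x).
have [s [t [sh th E1]]] := mixed_difference x h0 da dab.
have [s' [t' [sh' th' E2]]] := mixed_difference x h0 db dba.
have E : 'D_b ('D_a u) (x + s *: a + t *: b) = 'D_a ('D_b u) (x + s' *: b + t' *: a).
  apply: (@mulIf _ (h ^+ 2)); first by rewrite expf_neq0// gt_eqF.
  apply: (etrans (esym E1)); apply: (etrans _ E2).
  by rewrite (addrAC x (h *: b)); ring.
have h1 := B2 (x + s *: a + t *: b).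
have h2 := B1 (x + s' *: b + t' *: a).
have := h2; have := h1; rewrite -!ball_normE /ball_ /= => {}h1 {}h2.
have {}h1 := h1 (lt_le_trans (near_x _ _ sh th) _).
have {}h2 : `|'D_a ('D_b u) x - 'D_a ('D_b u) (x + s' *: b + t' *: a)| < e / 2.
  by apply: h2; apply: lt_le_trans (near' _ _ sh' th') _; rewrite ge_min lexx.
rewrite (_ : _ - _ = ('D_b ('D_a u) x - 'D_b ('D_a u) (x + s *: a + t *: b)) -
  ('D_a ('D_b u) x - 'D_a ('D_b u) (x + s' *: b + t' *: a))); last first.
  by rewrite E opprB addrA subrK.
apply: le_trans (ler_normB _ _) _; rewrite (splitr e); apply: lerD; last exact: ltW.
by apply/ltW/h1; rewrite ge_min lexx orbT.
Qed.

End Lines.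

Section SmoothFunctions.
Context {R : realType} {N : nat}.
Local Notation E := 'rV[R]_N.
Local Notation e_ i := (delta_mx ord0 i : E).
Implicit Types (f g : E -> R[i]) (i j : 'I_N) (s : seq 'I_N).

Lemma partials_cat s s' f : partials (s ++ s') f = partials s (partials s' f).
Proof. exact: foldr_cat. Qed.

Lemma smooth_partials s f : smooth f -> smooth (partials s f).
Proof. by move=> sf s'; rewrite -partials_cat; exact: sf. Qed.

Lemma partialC f i j : smooth f -> partial i (partial j f) = partial j (partial i f).
Proof.
move=> sf; have [_ _ d0] := sf [::].
have [_ _ di] := sf [:: i]; have [_ _ dj] := sf [:: j].
have [rij iij _] := sf [:: i; j]; have [rji iji _] := sf [:: j; i].
apply/funext => x.
exact: (f_equal2 (@Complex R)
  (schwarz (fun y => (d0 y j).1) (fun y => (d0 y i).1)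
    (fun y => (dj y i).1) (fun y => (di y j).1) (rij x) (rji x))
  (schwarz (fun y => (d0 y j).2) (fun y => (d0 y i).2)
    (fun y => (dj y i).2) (fun y => (di y j).2) (iij x) (iji x))).
Qed.

(** Adjacent derivatives commute by [partialC], so any entry can be moved to the front
    ([move_front]); induction then matches the heads. *)
Lemma partials_perm s s' f : smooth f -> perm_eq s s' -> partials s f = partials s' f.
Proof.
move=> sf; have move_front s1 i s2 :
    partials (s1 ++ i :: s2) f = partials (i :: s1 ++ s2) f.
  elim: s1 => //= j s1 IH; rewrite IH /= partialC//.
  exact: smooth_partials.
elim: s s' => [s'|i s IH s' ss']; first by rewrite perm_sym => /perm_nilP ->.
have is' : i \in s' by rewrite -(perm_mem ss') mem_head.
case: (path.splitPr is') ss' => s1 s2 ss'.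
rewrite move_front /= (IH (s1 ++ s2))//.
by move: ss'; rewrite perm_sym perm_catC /= perm_cons perm_catC perm_sym.
Qed.

Lemma mpartial_incr (a b : {ffun 'I_N -> nat}) i f : smooth f ->
  (forall j, b j = a j + (j == i))%N -> mpartial b f = partial i (mpartial a f).
Proof.
move=> sf ba; rewrite /mpartial -[RHS]/(partials (i :: _) f).
(* Two lists of directions are permutations of each other once all their counts agree, and the
   counts can be read off the multi-index. *)
have count_multi P (c : {ffun 'I_N -> nat}) :
    count P (flatten [seq nseq (c j) j | j <- enum 'I_N]) = (\sum_j P j * c j)%N.
  rewrite count_flatten sumnE big_map big_map big_enum.
  by apply: eq_bigr => j _; rewrite count_nseq.
apply: partials_perm => //; apply/permP => P /=; rewrite !count_multi.
rewrite (bigD1 i)//= [in RHS](bigD1 i)//= ba eqxx addn1 mulnS -addnA; congr addn.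
congr addn.
by apply: eq_bigr => j /negPf ji; rewrite ba ji addn0.
Qed.

Lemma re_partialD_Z (a : R[i]) f g x :
  re_part (a *: f + g) x =
  complex.Re a * re_part f x - complex.Im a * im_part f x + re_part g x.
Proof.
by rewrite /re_part /im_part; case: a => ar ai /=; rewrite /GRing.add /GRing.scale/=;
  case: (f x) => fr fi; case: (g x).
Qed.

Lemma im_partialD_Z (a : R[i]) f g x :
  im_part (a *: f + g) x =
  complex.Re a * im_part f x + complex.Im a * re_part f x + im_part g x.
Proof.
by rewrite /re_part /im_part; case: a => ar ai /=; rewrite /GRing.add /GRing.scale/=;
  case: (f x) => fr fi; case: (g x).
Qed.

End SmoothFunctions.

Lemma is_derive_lin2 {R : realType} {V : normedModType R} (u v g : V -> R) (a b : R)
    (x d : V) : derivable u x d -> derivable v x d -> derivable g x d ->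
  is_derive x d (fun y => a * u y + b * v y + g y)
    (a * 'D_d u x + b * 'D_d v x + 'D_d g x).
Proof.
move=> du dv dg; apply: is_deriveD; last exact: derivableP.
by apply: is_deriveD; apply: is_deriveZ; exact: derivableP.
Qed.

Lemma continuous_lin2 {R : realType} {V : topologicalType} (u v g : V -> R) (a b : R) :
  continuous u -> continuous v -> continuous g ->
  continuous (fun y => a * u y + b * v y + g y).
Proof.
move=> cu cv cg x; apply: cvgD; last exact: cg.
by apply: cvgD; apply: cvgMl_tmp; [exact: cu|exact: cv].
Qed.

Lemma continuous_hypot {R : realType} {V : topologicalType} (u v : V -> R) :
  continuous u -> continuous v -> continuous (fun x => Num.sqrt (u x ^+ 2 + v x ^+ 2)).
Proof.
move=> cu cv x.
have sq (w : V -> R) : continuous w -> w y ^+ 2 @[y --> x] --> w x ^+ 2.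
  by move=> cw; rewrite expr2; apply: cvgM; exact: cw.
by apply: (cvg_comp _ _ (cvgD (sq _ cu) (sq _ cv))); exact: sqrt_continuous.
Qed.

(** * Linearity of iterated derivatives and bounds for the modulus *)

Section Linearity.
Context {R : realType} {N : nat}.
Local Notation E := 'rV[R]_N.
Local Notation e_ i := (delta_mx ord0 i : E).
Implicit Types (f g : E -> R[i]) (i j : 'I_N) (s : seq 'I_N) (a : R[i]) (z : R[i]).

Lemma re_part_lin a f g : re_part (a *: f + g) =
  (fun x => complex.Re a * re_part f x + - complex.Im a * im_part f x + re_part g x).
Proof. by apply/funext => x; rewrite re_partialD_Z mulNr. Qed.

Lemma im_part_lin a f g : im_part (a *: f + g) =
  (fun x => complex.Re a * im_part f x + complex.Im a * re_part f x + im_part g x).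
Proof. by apply/funext => x; rewrite im_partialD_Z. Qed.

Definition derivable_parts f := forall x i,
  derivable (re_part f) x (e_ i) /\ derivable (im_part f) x (e_ i).

Lemma is_derive_parts_lin a f g x i : derivable_parts f -> derivable_parts g ->
  is_derive x (e_ i) (re_part (a *: f + g))
    (complex.Re a * 'D_(e_ i) (re_part f) x + - complex.Im a * 'D_(e_ i) (im_part f) x
      + 'D_(e_ i) (re_part g) x) /\
  is_derive x (e_ i) (im_part (a *: f + g))
    (complex.Re a * 'D_(e_ i) (im_part f) x + complex.Im a * 'D_(e_ i) (re_part f) x
      + 'D_(e_ i) (im_part g) x).
Proof.
move=> df dg; have [df1 df2] := df x i; have [dg1 dg2] := dg x i.
by rewrite re_part_lin im_part_lin; split; exact: is_derive_lin2.
Qed.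

Lemma derivable_parts_lin a f g : derivable_parts f -> derivable_parts g ->
  derivable_parts (a *: f + g).
Proof.
by move=> df dg x i; have [[? _] [? _]] := is_derive_parts_lin a x i df dg.
Qed.

Lemma partial_lin a f g i : derivable_parts f -> derivable_parts g ->
  partial i (a *: f + g) = a *: partial i f + partial i g.
Proof.
move=> df dg; apply/funext => x.
have [[_ e1] [_ e2]] := is_derive_parts_lin a x i df dg.
rewrite /partial e1 e2 [RHS]/GRing.add /= /GRing.scale /= mulNr.
by case: a {e1 e2}.
Qed.

Lemma smooth_derivable_parts f s : smooth f -> derivable_parts (partials s f).
Proof. by move=> /(_ s)[]. Qed.

Lemma partials_lin a f g s : smooth f -> smooth g ->
  partials s (a *: f + g) = a *: partials s f + partials s g.
Proof.
move=> sf sg; elim: s => //= i s ->.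
by apply: partial_lin; exact: smooth_derivable_parts.
Qed.

Lemma mpartial_lin a f g (b : {ffun 'I_N -> nat}) : smooth f -> smooth g ->
  mpartial b (a *: f + g) = a *: mpartial b f + mpartial b g.
Proof. exact: partials_lin. Qed.

Lemma smooth_lin a f g : smooth f -> smooth g -> smooth (a *: f + g).
Proof.
move=> sf sg s; rewrite partials_lin//.
have [rf mf _] := sf s; have [rg mg _] := sg s; split.
- by rewrite re_part_lin; exact: continuous_lin2.
- by rewrite im_part_lin; exact: continuous_lin2.
- by apply: derivable_parts_lin; exact: smooth_derivable_parts.
Qed.

Lemma smoothB f g : smooth f -> smooth g -> smooth (g - f).
Proof. by move=> sf sg; rewrite addrC -scaleN1r; exact: smooth_lin. Qed.

Lemma modulus_ge0 z : 0 <= modulus z.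
Proof. by case: z => x y; exact: sqrtr_ge0. Qed.

Lemma modulus_lin a z z' : modulus (a * z + z') <= modulus a * modulus z + modulus z'.
Proof.
by rewrite -ComplexField.Normc.normcM; exact: le_normcD.
Qed.

Lemma modulus_ge_Re z : `|complex.Re z| <= modulus z.
Proof.
case: z => x y /=; rewrite -sqrtr_sqr ler_sqrt ?addr_ge0 ?sqr_ge0//.
by rewrite lerDl sqr_ge0.
Qed.

Lemma modulus_ge_Im z : `|complex.Im z| <= modulus z.
Proof.
case: z => x y /=; rewrite -sqrtr_sqr ler_sqrt ?addr_ge0 ?sqr_ge0//.
by rewrite lerDr sqr_ge0.
Qed.

Lemma modulus_le z : modulus z <= `|complex.Re z| + `|complex.Im z|.
Proof.
case: z => x y /=.
rewrite -[leRHS]ger0_norm ?addr_ge0// -sqrtr_sqr ler_sqrt ?sqr_ge0//.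
by rewrite sqrrD !real_normK ?num_real// lerD2r lerDl mulrn_wge0// mulr_ge0.
Qed.

Lemma continuous_modulus f : continuous (re_part f) -> continuous (im_part f) ->
  continuous (fun x => modulus (f x)).
Proof.
move=> cr ci; rewrite (_ : (fun x => _) =
    (fun x => Num.sqrt (re_part f x ^+ 2 + im_part f x ^+ 2))).
  exact: continuous_hypot.
by apply/funext => x; rewrite /re_part /im_part /=; case: (f x).
Qed.

Lemma smooth_continuous_modulus b f : smooth f ->
  continuous (fun x => modulus (mpartial b f x)).
Proof.
by move=> /(_ (flatten [seq nseq (b i) i | i <- enum 'I_N]))[? ? _];
  exact: continuous_modulus.
Qed.

End Linearity.

(** * Integration over tuples *)

Section TupleMeasure.
Context {R : realType}.
Local Notation mR := (measurableTypeR R).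
Local Notation lam := (@lebesgue_measure R).

Definition row_of n (t : n.-tuple R) : 'rV[R]_n := \row_i tnth t i.

Definition grid (k : nat) (x : R) : R := (Num.floor (x * k.+1%:R))%:~R / k.+1%:R.

Lemma grid_dist k x : `|x - grid k x| <= k.+1%:R^-1.
Proof.
have /andP[h1 h2] := floor_itv (x * k.+1%:R).
have k0 : (0 : R) < k.+1%:R by rewrite ltr0n.
rewrite ger0_norm; last by rewrite subr_ge0 /grid ler_pdivrMr.
rewrite lerBlDr -[X in X + _]mul1r -mulrDl ler_pdivlMr//.
by rewrite addrC -[X in _ + X]/(1%:~R) -intrD ltW.
Qed.

(* [g] is the pointwise limit of its composites with the rounding maps [grid k],
   which take countably many values. *)
Lemma measurable_row_of n (g : 'rV[R]_n -> R) : continuous g ->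
  measurable_fun [set: n.-tuple mR] (fun t : n.-tuple mR => g (row_of t)).
Proof.
move=> cg.
pose h k (t : n.-tuple mR) := g (\row_i grid k (tnth t i)).
apply: (@measurable_fun_cvg _ _ _ _ h); last first.
  move=> t _; apply/cvgrPdist_lt => e e0.
  have /cvgrPdist_lt/(_ e e0)/nbhs_ballP[d /= d0 B] := cg (row_of t).
  near=> k; apply: B; split=> // i j; rewrite !mxE.
  rewrite -ball_normE /ball_ /= (le_lt_trans (grid_dist _ _))//.
  by near: k; exact: near_infty_natSinv_lt (PosNum d0).
move=> k _ B mB; rewrite setTI.
(* On the cell of points that round to [z] the composite is constant, so the second factor is either
   empty or the whole space. *)
rewrite (_ : _ @^-1` B = \bigcup_(z : {ffun 'I_n -> int})
    ([set t | forall i, Num.floor ((tnth t i : R) * k.+1%:R) = z i] `&`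
     [set t | B (g (\row_i ((z i)%:~R / k.+1%:R)))])); last first.
  apply/seteqP; split=> t /=.
    move=> Bt; exists [ffun i => Num.floor ((tnth t i : R) * k.+1%:R)] => //=.
    split; first by move=> i; rewrite ffunE.
    move: Bt; rewrite /h; congr (B (g _)).
    by apply/rowP => i; rewrite !mxE /grid ffunE.
  move=> [z _ [tz]]; rewrite /h; congr (B (g _)).
  by apply/rowP => i; rewrite !mxE /grid tz.
apply: countable_bigcupT_measurable => [|z]; first exact: countableP.
apply: measurableI; last first.
  have [Bz|Bz] := pselect (B (g (\row_i ((z i)%:~R / k.+1%:R)))).
    by rewrite (_ : [set _ | _] = setT)//; apply/seteqP; split.
  by rewrite (_ : [set _ | _] = set0)//; apply/seteqP; split.
rewrite (_ : [set _ | _] = \bigcap_(i in [set: 'I_n])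
    ((fun t : n.-tuple mR => tnth t i) @^-1`
       `[(z i)%:~R / k.+1%:R, (z i + 1)%:~R / k.+1%:R[)); last first.
  have k0 : (0 : R) < k.+1%:R by rewrite ltr0n.
  apply/seteqP; split=> t /= tz i.
    move=> _ /=; rewrite in_itv/= ler_pdivrMr// ltr_pdivlMr//.
    by rewrite -floor_eq tz.
  have := tz i I; rewrite /= in_itv/= ler_pdivrMr// ltr_pdivlMr//.
  by rewrite -floor_eq => /eqP.
apply: fin_bigcap_measurable => // i _; rewrite -[X in measurable X]setTI.
by apply: measurable_tnth => //; exact: measurable_itv.
Unshelve. all: end_near. Qed.

Lemma integral_tuple_cons n (F : n.+1.-tuple mR -> \bar R) :
  measurable_fun [set: n.+1.-tuple mR] F -> (forall t, (0 <= F t)%E) ->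
  (\int[lebesgue_tuple n.+1]_t F t =
   \int[lam]_x \int[lebesgue_tuple n]_t F [tuple of (x : mR) :: t])%E.
Proof.
move=> mF F0.
have mc := @measurable_tuple_cons R n.
transitivity (\int[pushforward (lam \x lebesgue_tuple n)%E (@tuple_cons R n)]_t F t)%E.
  by apply: eq_measure_integral => A mA _.
rewrite ge0_integral_pushforward// preimage_setT.
rewrite fubini_tonelli1//=.
exact: measurableT_comp.
Qed.

Lemma measurable_integral_tuple n (F : n.+1.-tuple mR -> \bar R) :
  measurable_fun [set: n.+1.-tuple mR] F -> (forall t, (0 <= F t)%E) ->
  measurable_fun [set: mR]
    (fun x : mR => \int[lebesgue_tuple n]_t F [tuple of x :: t])%E.
Proof.
move=> mF F0.
apply: (@measurable_fun_fubini_tonelli_F _ _ mR _ _ (lebesgue_tuple n)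
  (F \o @tuple_cons R n)); last by move=> z; exact: F0.
by apply: measurableT_comp => //; exact: measurable_tuple_cons.
Qed.

End TupleMeasure.

Section ProductIntegral.
Context {R : realType}.
Local Notation mR := (measurableTypeR R).
Local Notation lam := (@lebesgue_measure R).

Lemma measurable_prod_tuple n (g : 'I_n -> R -> R) :
  (forall i, measurable_fun [set: mR] (g i)) ->
  measurable_fun [set: n.-tuple mR] (fun t : n.-tuple mR => \prod_(i < n) g i (tnth t i)).
Proof.
move=> mg; apply: measurable_prod => i _.
by apply: (measurableT_comp (mg i)); exact: measurable_tnth.
Qed.

(** Iterated Tonelli. It is applied with [c] equal to pi, to dominate exp (- k w), and with [c]
    equal to 1, for the volume of the unit cube. *)
Lemma integral_prod_tuple n (g : 'I_n -> R -> R) (c : 'I_n -> R) :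
  (forall i, measurable_fun [set: mR] (g i)) -> (forall i x, 0 <= g i x) ->
  (forall i, \int[lam]_x (g i x)%:E = (c i)%:E)%E ->
  (\int[lebesgue_tuple n]_(t in setT) (\prod_(i < n) g i (tnth t i))%:E =
   (\prod_(i < n) c i)%:E)%E.
Proof.
elim: n g c => [|n IH] g c mg g0 gc.
  rewrite [LHS](_ : _ = \int[\d_([tuple] : 0.-tuple mR)]_(t in setT)
    (\prod_(i < 0) g i (tnth t i))%:E)%E//.
  rewrite integral_dirac//; last by apply/measurable_EFinP; exact: measurable_prod_tuple.
  by rewrite diracT mul1e !big_ord0.
pose g' i := g (lift ord0 i); pose c' i := c (lift ord0 i).
have {}IH := IH g' c' (fun i => mg _) (fun i => g0 _) (fun i => gc _).
rewrite integral_tuple_cons; last 2 first.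
- by have /measurable_EFinP := measurable_prod_tuple mg.
- by move=> t; rewrite lee_fin prodr_ge0.
transitivity (\int[lam]_x ((g ord0 x)%:E * (\prod_(i < n) c' i)%:E))%E.
  apply: eq_integral => x _; rewrite -IH -ge0_integralZl_EFin//.
  - apply: eq_integral => t _; rewrite big_ord_recl -EFinM; congr (_ * _)%:E.
    by apply: eq_bigr => i _; rewrite tnthS.
  - by move=> t _; rewrite lee_fin prodr_ge0// => i _; exact: g0.
  - by have /measurable_EFinP := measurable_prod_tuple (fun i => mg (lift ord0 i)).
have c0 i : 0 <= c i.
  by rewrite -lee_fin -gc; apply: integral_ge0 => x _; rewrite lee_fin.
rewrite ge0_integralZr//; first by rewrite gc -EFinM big_ord_recl.
- exact/measurable_EFinP.
- by move=> x _; rewrite lee_fin.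
- by rewrite lee_fin prodr_ge0// => i _; exact: c0.
Qed.

Lemma integral_oneDsqrV : (\int[lam]_x ((1 + x ^+ 2)^-1)%:E = (pi : R)%:E)%E.
Proof.
rewrite [LHS](_ : _ = \int[lam]_x ((oneDsqr x)^-1)%:E)%E//.
rewrite ge0_symfun_integralT.
- rewrite (_ : [set x | (0 <= x)%R] = `[0%R, +oo[%classic); last first.
    by apply/seteqP; split=> x /=; rewrite in_itv/= andbT.
  by rewrite integral0y_oneDsqr -EFinM mulrC divfK.
- by move=> x; rewrite invr_ge0 (le_trans ler01)// oneDsqr_ge1.
- exact: continuous_oneDsqrV.
- by move=> x; rewrite /oneDsqr /= sqrrN.
Qed.

Lemma integral_prod_oneDsqrV n :
  (\int[lebesgue_tuple n]_(t in setT) (\prod_(i < n) (1 + (tnth t i : R) ^+ 2)^-1)%:E =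
   ((pi : R) ^+ n)%:E)%E.
Proof.
rewrite (@integral_prod_tuple _ (fun=> fun x : R => (1 + x ^+ 2)^-1) (fun=> pi)).
- by rewrite prodr_const card_ord.
- by move=> _; exact: continuous_measurable_fun (@continuous_oneDsqrV R).
- by move=> _ x; rewrite invr_ge0 addr_ge0// sqr_ge0.
- by move=> _; exact: integral_oneDsqrV.
Qed.

End ProductIntegral.

Lemma continuous_expRN_scale {R : realType} {V : topologicalType} (u : V -> R) (c : R) :
  continuous u -> continuous (fun x => expR (- (c * u x))).
Proof.
move=> cu x; apply: continuous_comp; last exact: continuous_expR.
by apply: cvgN; apply: cvgMl_tmp; exact: cu.
Qed.

(** * The weight as a function on R^N and the integrability of exp (- k w) *)

Section WeightRow.
Context {R : realType} {N : nat} (w : R -> R).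
Hypothesis Hw : nonquasianalytic_weight w.
Implicit Types x : 'rV[R]_N.

Lemma enorm_ge0 x : 0 <= enorm x.
Proof. exact: sqrtr_ge0. Qed.

Lemma sqr_enorm x : enorm x ^+ 2 = \sum_i x ord0 i ^+ 2.
Proof. by rewrite sqr_sqrtr// sumr_ge0// => i _; exact: sqr_ge0. Qed.

Lemma ler_enorm x i : `|x ord0 i| <= enorm x.
Proof.
rewrite -[leRHS]ger0_norm ?enorm_ge0// -ler_sqr ?nnegrE//.
rewrite !real_normK ?num_real// sqr_enorm (bigD1 i)//= lerDl.
by rewrite sumr_ge0// => j _; exact: sqr_ge0.
Qed.

Lemma continuous_enorm : continuous (@enorm R N).
Proof.
have sqr_cvg (y : 'rV[R]_N) i : z ord0 i ^+ 2 @[z --> y] --> y ord0 i ^+ 2.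
  by rewrite expr2; apply: cvgM; exact: coord_continuous.
have sum_sqr : continuous (fun y : 'rV[R]_N => \sum_i y ord0 i ^+ 2).
  apply: (continuous_big (op := +%R)) => [|i _ y]; first exact: add_continuous.
  exact: sqr_cvg.
by move=> x; apply: continuous_comp; [exact: sum_sqr|exact: sqrt_continuous].
Qed.

(** [w] is only known to be continuous within [0, +oo[, which says nothing two-sided at 0. Inside
    the unit ball the composite is constantly 0; elsewhere [enorm x] is an interior point of the
    half-line. *)
Lemma continuous_weight x : {for x, continuous (fun y => w (enorm y))}.
Proof.
have [x1|x1] := ltP (enorm x) 1.
  apply: (@near_cst_continuous _ _ 0).
  have : \forall y \near x, enorm y < 1 by exact: (continuous_enorm (lt_nbhsl x1)).
  by apply: filterS => y y1; rewrite (weight_eq0 Hw)// ?enorm_ge0// ltW.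
apply: (@continuous_comp _ _ _ (@enorm R N) w); first exact: continuous_enorm.
have /continuous_within_itvcyP[+ _] := weight_continuous Hw.
by apply; rewrite in_itv/= andbT (lt_le_trans ltr01).
Qed.

Lemma continuous_expweight (c : R) : continuous (fun x => expR (- (c * w (enorm x)))).
Proof.
exact: continuous_expRN_scale continuous_weight.
Qed.

Lemma weight_integral_lt_pinfty : exists k : nat,
  (\int[lebesgue_tuple N]_(t in setT)
    (expR (- (k%:R * w (enorm (row_of t)))))%:E < +oo)%E.
Proof.
have [a [b [b0 wab]]] := weight_gamma Hw.
(* Since k b >= 2 N, (gamma) bounds exp (- k w) by a multiple of (1 + r)^(-2N), that is, two powers
   of 1 + r for each coordinate. *)
pose k := (Num.truncn (N.*2%:R / b)).+1.
have kb : N.*2%:R <= k%:R * b.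
  by rewrite -ler_pdivrMr// ltW// truncnS_gt.
exists k.
have bnd (t : N.-tuple R) : expR (- (k%:R * w (enorm (row_of t)))) <=
    expR (- (k%:R * a)) * \prod_(i < N) (1 + (tnth t i : R) ^+ 2)^-1.
  set r := enorm (row_of t); have r0 : 0 <= r := enorm_ge0 _.
  have l0 : 0 <= ln (1 + r) by rewrite ln_ge0// lerDl.
  apply: (@le_trans _ _ (expR (- (k%:R * a) - N.*2%:R * ln (1 + r)))).
    rewrite ler_expR -opprD lerN2 (@le_trans _ _ (k%:R * (a + b * ln (1 + r))))//.
      by rewrite mulrDr lerD2l mulrA ler_wpM2r.
    by rewrite ler_wpM2l// wab.
  rewrite expRD ler_wpM2l ?expR_ge0// expRN expRM_natl lnK ?posrE ?ltr_pwDl//.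
  rewrite -mul2n exprM -[N in _ ^+ N]card_ord -prodr_const -prodfV.
  apply: ler_prod => i _; rewrite invr_ge0 exprn_ge0 ?addr_ge0//=.
  rewrite lef_pV2 ?posrE ?exprn_gt0 ?ltr_pwDl ?sqr_ge0//.
  (* For each coordinate, (1 + r)^2 >= 1 + r^2 >= 1 + t_i^2. *)
  have := ler_enorm (row_of t) i; rewrite mxE -/r => tr.
  have : `|tnth t i| ^+ 2 <= r ^+ 2 by rewrite ler_pXn2r ?nnegrE.
  by rewrite real_normK ?num_real// => tr2; nra.
have mJ : measurable_fun [set: N.-tuple (measurableTypeR R)]
    (fun t : N.-tuple (measurableTypeR R) =>
      (\prod_(i < N) (1 + (tnth t i : R) ^+ 2)^-1)%:E).
  apply/measurable_EFinP.
  apply: (measurable_prod_tuple (g := fun=> fun x : R => (1 + x ^+ 2)^-1)) => _.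
  exact: continuous_measurable_fun (@continuous_oneDsqrV R).
apply: (@le_lt_trans _ _ (\int[lebesgue_tuple N]_(t in setT)
    ((expR (- (k%:R * a)))%:E * (\prod_(i < N) (1 + (tnth t i : R) ^+ 2)^-1)%:E))%E).
  apply: ge0_le_integral => //.
  - apply/measurable_EFinP.
    apply: (measurable_row_of (g := fun x => expR (- (k%:R * w (enorm x))))).
    exact: continuous_expweight.
  - exact: measurable_funeM.
  - by move=> t _; rewrite -EFinM lee_fin; exact: bnd.
rewrite ge0_integralZl_EFin ?expR_ge0//.
  by rewrite integral_prod_oneDsqrV -EFinM ltry.
move=> t _; rewrite lee_fin prodr_ge0// => i _.
by rewrite invr_ge0 addr_ge0// sqr_ge0.
Qed.

End WeightRow.

(** * A Sobolev inequality on the unit cube *)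

Section UnitInterval.
Context {R : realType}.
Local Notation mR := (measurableTypeR R).
Local Notation lam := (@lebesgue_measure R).

Lemma abs_le_integral_unit (h h' : R -> R) (x : R) :
  (forall s : R, is_derive s 1 h (h' s)) -> continuous h' ->
  (`|h x|%:E <= \int[lam]_(s in `[x, (x + 1)%R]) `|h s|%:E
              + \int[lam]_(s in `[x, (x + 1)%R]) `|h' s|%:E)%E.
Proof.
move=> dh ch'.
have ch : continuous h.
  by move=> s; apply/differentiable_continuous/derivable1_diffP; have [] := dh s.
have mabs (g : R -> R) (D : set R) : measurable D -> continuous g ->
    measurable_fun (D : set mR) (fun s => (`|g s|)%:E).
  move=> mD cg; apply/measurable_EFinP; apply: measurable_funTS.
  by apply: measurableT_comp => //; exact: continuous_measurable_fun.
have mI : measurable (`[x, (x + 1)%R] : set mR) by exact: measurable_itv.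
pose J := (\int[lam]_(s in `[x, (x + 1)%R]) `|h' s|%:E)%E.
have J0 : (0 <= J)%E by apply: integral_ge0 => s _; rewrite lee_fin.
(* [h x] differs from [h s] by the integral of [h'] over [[x, s]]; average over [s]. *)
have key s : `[x, (x + 1)%R]%classic s -> (`|h x|%:E <= `|h s|%:E + J)%E.
  rewrite /= in_itv/= => /andP[]; rewrite le_eqVlt => /predU1P[<- _|xs sx].
    by rewrite leeDl.
  have ftc : (\int[lam]_(r in `[x, s]) (h' r)%:E = (h s)%:E - (h x)%:E)%E.
    apply: continuous_FTC2 => //.
    - exact: continuous_subspaceT.
    - split=> [r _||]; first by have [] := dh r.
      + exact: cvg_at_right_filter (ch _).
      + exact: cvg_at_left_filter (ch _).
    - by move=> r _; rewrite derive1E; have [_ ->] := dh r.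
  have diff : (`|h s - h x|%:E <= J)%E.
    rewrite -[X in (X <= _)%E]/(`|(h s)%:E - (h x)%:E|)%E -ftc.
    apply: le_trans (le_abse_integral _ _ _) _ => //.
      apply/measurable_EFinP; apply: measurable_funTS.
      exact: continuous_measurable_fun.
    apply: ge0_subset_integral => //.
    - exact: mabs.
    - by apply: subset_itvl; rewrite bnd_simp.
  rewrite (le_trans (_ : _ <= `|h s|%:E + `|h s - h x|%:E)%E) ?leeD2l//.
  rewrite -EFinD lee_fin -[X in `|X| <= _](subKr (h s)).
  exact: ler_normB.
have lamI : lam `[x, (x + 1)%R] = 1%E.
  by rewrite lebesgue_measure_itv/= lte_fin ltrDl ltr01 -EFinD addrAC subrr add0r.
have cstI c : (0 <= c)%E -> (\int[lam]_(s in `[x, (x + 1)%R]) c = c)%E.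
  by move=> c0; rewrite integral_cst// [X in (_ * X)%E]lamI mule1.
rewrite -[X in (X <= _)%E]cstI ?lee_fin// -[X in (_ <= _ + X)%E](cstI J)//.
rewrite -ge0_integralD//; last exact: mabs.
apply: ge0_le_integral => //.
by apply: emeasurable_funD => //; exact: mabs.
Qed.

End UnitInterval.

Section CubeSobolev.
Context {R : realType}.
Local Notation mR := (measurableTypeR R).
Local Notation lam := (@lebesgue_measure R).

(** As [v] varies this runs along the line through [t] in direction [i], so it expresses partial
    derivatives on tuples. On tuples of booleans it records that one more direction has been
    differentiated. *)
Definition upd_tuple (T : Type) n (t : n.-tuple T) (i : 'I_n) (v : T) : n.-tuple T :=
  [tuple if j == i then v else tnth t j | j < n].

Lemma upd_tuple_cons0 T n (v u : T) (t : n.-tuple T) :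
  upd_tuple [tuple of v :: t] ord0 u = [tuple of u :: t].
Proof.
apply: eq_from_tnth => j; rewrite tnth_mktuple.
by case: (unliftP ord0 j) => [k|] -> //; rewrite !tnthS.
Qed.

Lemma upd_tuple_consS T n (v u : T) (t : n.-tuple T) (i : 'I_n) :
  upd_tuple [tuple of v :: t] (lift ord0 i) u = [tuple of v :: upd_tuple t i u].
Proof.
apply: eq_from_tnth => j; rewrite tnth_mktuple.
case: (unliftP ord0 j) => [k|] -> //; rewrite !tnthS (inj_eq lift_inj).
by rewrite tnth_mktuple.
Qed.

Lemma big_tuple_bool_cons n (F : n.+1.-tuple bool -> \bar R) :
  (\sum_b F b = \sum_(b : n.-tuple bool) F [tuple of false :: b] +
    \sum_(b : n.-tuple bool) F [tuple of true :: b])%E.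
Proof.
rewrite (reindex (fun p : bool * n.-tuple bool => [tuple of p.1 :: p.2])) /=.
  rewrite -(pair_bigA _ (fun b (t : n.-tuple bool) => F [tuple of b :: t])) /=.
  by rewrite big_bool addeC.
exists (fun t => (thead t, [tuple of behead t])) => [[b t] _|t _] /=.
  by congr (_, _); exact/val_inj.
by rewrite -tuple_eta.
Qed.

(** Indicator of the unit cube with lower corner [x]. The product form splits off one coordinate at
    a time under Tonelli, and all integrals stay over the full space. *)
Definition cube n (x t : n.-tuple R) : R :=
  \prod_(i < n) \1_(`[tnth x i, tnth x i + 1]%classic : set R) (tnth t i).

Lemma cube_ge0 n (x t : n.-tuple R) : 0 <= cube x t.
Proof. by apply: prodr_ge0 => i _; rewrite indicE. Qed.

Lemma cube_cons n (a b : R) (x t : n.-tuple R) :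
  cube [tuple of a :: x] [tuple of b :: t] = \1_(`[a, a + 1]%classic : set R) b * cube x t.
Proof.
rewrite /cube big_ord_recl; congr (_ * _).
by apply: eq_bigr => i _; rewrite !tnthS.
Qed.

Lemma measurable_cube n (x : n.-tuple R) :
  measurable_fun [set: n.-tuple mR] (fun t : n.-tuple mR => cube x t).
Proof.
apply: measurable_prod => i _.
have mI : measurable_fun [set: mR]
    (\1_(`[tnth x i, tnth x i + 1]%classic : set mR) : mR -> R).
  by apply: measurable_indic; exact: measurable_itv.
exact: (measurableT_comp mI (measurable_tnth i)).
Qed.

Lemma measurable_cube_abs n (x : n.-tuple R) (g : n.-tuple mR -> R) :
  measurable_fun [set: n.-tuple mR] g ->
  measurable_fun [set: n.-tuple mR] (fun t => (cube x t * `|g t|)%:E).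
Proof.
move=> mg; apply/measurable_EFinP.
apply: measurable_funM; first exact: measurable_cube.
exact: measurableT_comp.
Qed.

(* [G b] stands for the derivative of [G 0] once in each direction [i] with
   [b i = true]. *)
Lemma cube_sobolev n (G : n.-tuple bool -> n.-tuple mR -> R) (x : n.-tuple R) :
  (forall b, measurable_fun [set: n.-tuple mR] (G b)) ->
  (forall b i t, tnth b i = false ->
     (forall s : R, is_derive s 1 (fun s => G b (upd_tuple t i s))
         (G (upd_tuple b i true) (upd_tuple t i s))) /\
     continuous (fun s : R => G (upd_tuple b i true) (upd_tuple t i s))) ->
  (`|G [tuple of nseq n false] x|%:E <=
   \sum_(b : n.-tuple bool) \int[lebesgue_tuple n]_t (cube x t * `|G b t|)%:E)%E.
Proof.
elim: n G x => [|n IH] G x mG dG.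
  rewrite (bigD1 [tuple of nseq 0 false])//=.
  apply: (@le_trans _ _ (\int[lebesgue_tuple 0]_t
      (cube x t * `|G [tuple of nseq 0 false] t|)%:E)%E); last first.
    rewrite leeDl//; apply: sume_ge0 => b _; apply: integral_ge0 => t _.
    by rewrite lee_fin mulr_ge0 ?cube_ge0.
  rewrite [leRHS](_ : _ = \int[\d_([tuple] : 0.-tuple mR)]_t
    (cube x t * `|G [tuple of nseq 0 false] t|)%:E)%E//.
  rewrite integral_dirac//; last exact: measurable_cube_abs.
  by rewrite diracT mul1e /cube big_ord0 mul1r lee_fin (tuple0 x).
case/tupleP: x => x0 x.
set z := [tuple of nseq n false].
rewrite (_ : [tuple of nseq n.+1 false] = [tuple of false :: z]); last exact/val_inj.
have d0 := dG [tuple of false :: z] ord0 [tuple of x0 :: x] erefl.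
pose h b s := G [tuple of b :: z] [tuple of (s : mR) :: x].
have [dh ch] : (forall s : R, is_derive s 1 (h false) (h true s)) /\ continuous (h true).
  have [dh ch] := d0; split=> [s|s].
    have := dh s; rewrite !upd_tuple_cons0.
    by under [X in is_derive _ _ X]eq_fun do rewrite upd_tuple_cons0.
  have := ch s; rewrite upd_tuple_cons0.
  by under [X in continuous_at _ X]eq_fun do rewrite upd_tuple_cons0.
(* The one-dimensional inequality in the first coordinate leaves an integral of |h b| for each first
   bit [b]. For each frozen value [s] of that coordinate the induction hypothesis bounds |h b s|,
   and Tonelli reassembles the integral. *)
have step b : continuous (h b) ->
    (\int[lam]_(s in `[x0, (x0 + 1)%R]) `|h b s|%:E <=
     \sum_(b' : n.-tuple bool) \int[lebesgue_tuple n.+1]_t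
        (cube [tuple of x0 :: x] t * `|G [tuple of b :: b'] t|)%:E)%E.
  move=> chb.
  pose H (b' : n.-tuple bool) (s : mR) := (\int[lebesgue_tuple n]_t
    (cube x t * `|G [tuple of b :: b'] [tuple of s :: t]|)%:E)%E.
  have IHs s : (`|h b s|%:E <= \sum_(b' : n.-tuple bool) H b' s)%E.
    apply: (IH (fun b' t => G [tuple of b :: b'] [tuple of (s : mR) :: t])).
      move=> b'; apply: (measurableT_comp (mG _)); exact: measurable_cons.
    move=> b' i t b'i.
    have [] := dG [tuple of b :: b'] (lift ord0 i) [tuple of s :: t].
      by rewrite tnthS.
    move=> dh' ch'; split=> [r|r].
      have := dh' r; rewrite !upd_tuple_consS.
      by under [X in is_derive _ _ X]eq_fun do rewrite upd_tuple_consS.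
    have := ch' r; rewrite !upd_tuple_consS.
    by under [X in continuous_at _ X]eq_fun do rewrite upd_tuple_consS.
  have H0 b' s : (0 <= H b' s)%E.
    by apply: integral_ge0 => t _; rewrite lee_fin mulr_ge0 ?cube_ge0.
  have mH b' : measurable_fun [set: mR] (H b').
    pose F (t : n.+1.-tuple mR) :=
      (cube x [tuple of behead t] * `|G [tuple of b :: b'] t|)%:E.
    have mF : measurable_fun [set: n.+1.-tuple mR] F.
      apply/measurable_EFinP; apply: measurable_funM.
        by apply: (measurableT_comp (measurable_cube x)); exact: measurable_behead.
      by apply: measurableT_comp => //; exact: mG.
    have F0 t : (0 <= F t)%E by rewrite lee_fin mulr_ge0 ?cube_ge0.
    have := measurable_integral_tuple mF F0.
    congr (measurable_fun _ _); apply/funext => s; apply: eq_integral => t _.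
    by rewrite /F; congr (cube x _ * _)%:E; exact/val_inj.
  have slice b' : (\int[lam]_(s in `[x0, (x0 + 1)%R]) H b' s =
      \int[lebesgue_tuple n.+1]_t
        (cube [tuple of x0 :: x] t * `|G [tuple of b :: b'] t|)%:E)%E.
    rewrite integral_tuple_cons; last 2 first.
    - exact: measurable_cube_abs.
    - by move=> t; rewrite lee_fin mulr_ge0 ?cube_ge0.
    rewrite integral_mkcond; apply: eq_integral => s _; rewrite patchE.
    under eq_integral do rewrite cube_cons indicE.
    case: ifPn => _; first by under eq_integral do rewrite mul1r.
    under eq_integral do rewrite !mul0r.
    by rewrite integral0.
  under eq_bigr do rewrite -slice.
  rewrite -ge0_integral_sum//; last by move=> b'; exact: measurable_funTS.
  apply: ge0_le_integral => //.
  - apply/measurable_EFinP; apply: measurable_funTS.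
    by apply: measurableT_comp => //; exact: continuous_measurable_fun.
  - by apply: emeasurable_sum => b'; exact: measurable_funTS.
rewrite big_tuple_bool_cons.
apply: le_trans (abs_le_integral_unit x0 dh ch) _.
apply: leeD; apply: step => //.
by move=> s; apply/differentiable_continuous/derivable1_diffP; have [] := dh s.
Qed.

End CubeSobolev.

Section MultiIndexSobolev.
Context {R : realType} {N : nat}.
Local Notation mR := (measurableTypeR R).
Local Notation lam := (@lebesgue_measure R).
Local Notation E := 'rV[R]_N.
Local Notation e_ i := (delta_mx ord0 i : E).
Implicit Types (a : {ffun 'I_N -> nat}) (b : N.-tuple bool) (f : E -> R[i]).

Definition tuple_of (x : E) : N.-tuple R := [tuple x ord0 i | i < N].

Lemma tuple_ofK x : row_of (tuple_of x) = x.
Proof. by apply/rowP => i; rewrite mxE tnth_mktuple. Qed.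

Lemma row_of_upd (t : N.-tuple R) i s :
  row_of (upd_tuple t i s) = row_of (upd_tuple t i 0) + s *: e_ i.
Proof.
apply/rowP => j; rewrite !mxE !tnth_mktuple eqxx/= eq_sym.
by case: eqVneq => _; rewrite ?mulr1 ?add0r// mulr0 addr0.
Qed.

Lemma integral_cube (x : N.-tuple R) :
  (\int[lebesgue_tuple N]_(t in setT) (cube x t)%:E = 1)%E.
Proof.
rewrite /cube (@integral_prod_tuple _ _
  (fun i => \1_(`[tnth x i, tnth x i + 1]%classic : set R)) (fun=> 1)).
- by rewrite prodr_const expr1n.
- by move=> i; apply: measurable_indic; exact: measurable_itv.
- by move=> i y; rewrite indicE.
- move=> i; rewrite integral_indic//= setIT [LHS]lebesgue_measure_itv/= lte_fin.
  by rewrite ltrDl ltr01 -EFinD addrAC subrr add0r.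
Qed.

Definition incr a b : {ffun 'I_N -> nat} := [ffun i => (a i + tnth b i)%N].

Lemma incr0 a : incr a [tuple of nseq N false] = a.
Proof. by apply/ffunP => i; rewrite ffunE tnth_nseq addn0. Qed.

Lemma mlength_incr a b : (mlength (incr a b) <= mlength a + N)%N.
Proof.
rewrite /mlength (eq_bigr (fun i => a i + tnth b i)%N) => [|i _]; last by rewrite ffunE.
rewrite big_split leq_add2l/= -[X in (_ <= X)%N]card_ord -sum1_card leq_sum// => i _.
by case: (tnth b i).
Qed.

(** [P] stands for [re_part] or [im_part]: the cube inequality rests on the fundamental theorem of
    calculus for real functions. *)
Lemma component_sobolev (P : (E -> R[i]) -> E -> R) a f x : smooth f ->
  (forall s, continuous (P (partials s f))) ->
  (forall s i y, derivable (P (partials s f)) y (e_ i)) ->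
  (forall g i y, 'D_(e_ i) (P g) y = P (partial i g) y) ->
  (`|P (mpartial a f) x|%:E <= \sum_(b : N.-tuple bool) \int[lebesgue_tuple N]_t
     (cube (tuple_of x) t * `|P (mpartial (incr a b) f) (row_of t)|)%:E)%E.
Proof.
move=> sf cP dP DP.
have := @cube_sobolev R N (fun b t => P (mpartial (incr a b) f) (row_of t)) (tuple_of x).
rewrite tuple_ofK incr0; apply.
  by move=> b; apply: (measurable_row_of (g := P (mpartial (incr a b) f))); exact: cP.
move=> b i t bi.
have incrE : mpartial (incr a (upd_tuple b i true)) f = partial i (mpartial (incr a b) f).
  apply: mpartial_incr => // j; rewrite !ffunE tnth_mktuple.
  by case: eqVneq => [->|_]; rewrite ?bi ?addn0.
have rowE (s : R) := row_of_upd t i s.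
split=> [s|].
  rewrite incrE rowE -DP.
  under [X in is_derive _ _ X]eq_fun do rewrite row_of_upd.
  by apply: is_derive_line; exact: dP.
rewrite incrE; under [X in continuous X]eq_fun do rewrite row_of_upd.
apply: continuous_line.
exact: (cP (i :: flatten [seq nseq (incr a b j) j | j <- enum 'I_N])).
Qed.

Lemma re_sobolev a f x : smooth f ->
  (`|re_part (mpartial a f) x|%:E <= \sum_(b : N.-tuple bool) \int[lebesgue_tuple N]_t
     (cube (tuple_of x) t * `|re_part (mpartial (incr a b) f) (row_of t)|)%:E)%E.
Proof.
move=> sf; apply: component_sobolev => // s.
- by have [? _ _] := sf s.
- by move=> i y; have [_ _ d] := sf s; have [] := d y i.
Qed.

Lemma im_sobolev a f x : smooth f ->
  (`|im_part (mpartial a f) x|%:E <= \sum_(b : N.-tuple bool) \int[lebesgue_tuple N]_t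
     (cube (tuple_of x) t * `|im_part (mpartial (incr a b) f) (row_of t)|)%:E)%E.
Proof.
move=> sf; apply: component_sobolev => // s.
- by have [_ ? _] := sf s.
- by move=> i y; have [_ _ d] := sf s; have [] := d y i.
Qed.

End MultiIndexSobolev.

(** * Young conjugates *)

Section YoungTerm.
Context {R : realType} {N : nat} (w : R -> R).
Hypothesis Hw : nonquasianalytic_weight w.
Implicit Types (a b : {ffun 'I_N -> nat}) (m : nat) (t y : R).

(** Multiplied out, m phi^*(|a| / m) is the supremum over t >= 0 of |a| t - m w (e^t). This lemma
    and [young_term_ge] are the two halves of that description. *)
Lemma young_term_le m a y : (0 < m)%N ->
  (forall t, 0 <= t -> (mlength a)%:R * t - m%:R * w (expR t) <= y) ->
  (young_term w m a <= y%:E)%E.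
Proof.
move=> m0 ub; have mR0 : (0 : R) < m%:R by rewrite ltr0n.
rewrite /young_term (_ : y%:E = m%:R%:E * (y / m%:R)%:E)%E; last first.
  by rewrite -EFinM mulrC divfK// gt_eqF.
rewrite lee_pmul2l//; apply: ge_ereal_sup => _ [t /= + <-].
rewrite in_itv/= andbT => t0; rewrite lee_fin ler_pdivlMr//.
rewrite (le_trans _ (ub t t0))// le_eqVlt; apply/orP; left; apply/eqP.
by field; rewrite gt_eqF.
Qed.

Lemma young_term_ge m a t : (0 < m)%N -> 0 <= t ->
  (((mlength a)%:R * t - m%:R * w (expR t))%:E <= young_term w m a)%E.
Proof.
move=> m0 t0; have mR0 : (0 : R) < m%:R by rewrite ltr0n.
rewrite /young_term (_ : (_ - _)%:E =
  m%:R%:E * ((mlength a)%:R / m%:R * t - w (expR t))%:E)%E; last first.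
  by rewrite -EFinM; congr (_%:E); field; rewrite gt_eqF.
rewrite lee_pmul2l//; apply: ereal_sup_ubound; exists t => //=.
by rewrite in_itv/= t0.
Qed.

(** The term t = 0 of the supremum vanishes because w 1 = 0. This excludes the value -oo in the
    later case analyses. *)
Lemma young_term_ge0 m a : (0 < m)%N -> (0 <= young_term w m a)%E.
Proof.
move=> m0; apply: le_trans (young_term_ge a m0 (lexx 0)).
by rewrite expR0 (weight_eq0 Hw)// !mulr0 subr0.
Qed.

(** Evaluate the supremum for [m] at t + ln 2: from w (2 e^t) <= k (1 + w (e^t)) one gets |a| t - m
    k w (e^t) <= y - |a| ln 2 + m k. The factor [k] is the constant of (alpha) rounded up to an
    integer, and does not depend on [m]. *)
Lemma young_term_alpha : exists2 k : nat, (0 < k)%N &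
  forall m, (0 < m)%N -> exists c : R, forall a y, young_term w m a = y%:E ->
    (young_term w (m * k) a <= (y - (mlength a)%:R * ln 2 + c)%:E)%E.
Proof.
have [K0 K1 alpha] := weight_alpha Hw.
pose k := (Num.truncn K0).+1.
have K0k : K0 <= k%:R by rewrite ltW// truncnS_gt.
exists k => // m m0; exists (m%:R * k%:R) => a y ya.
apply: young_term_le => [|t t0]; first by rewrite muln_gt0 m0.
have ln20 : (0 : R) <= ln 2 by rewrite ln_ge0// ler1n.
have := young_term_ge a m0 (addr_ge0 t0 ln20); rewrite ya lee_fin.
rewrite expRD lnK ?posrE// [expR t * 2]mulrC => h.
have wt0 : 0 <= w (expR t) by apply: (weight_ge0 Hw); exact: expR_ge0.
have h2 : w (2 * expR t) <= k%:R * (1 + w (expR t)).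
  by apply: le_trans (alpha _ (expR_ge0 _)) _; rewrite ler_wpM2r ?addr_ge0.
have h3 : m%:R * w (2 * expR t) <= m%:R * (k%:R * (1 + w (expR t))).
  by rewrite ler_wpM2l.
by rewrite natrM; nra.
Qed.

(** At most [d] extra derivatives cost d t in the supremum. By (gamma), q w (e^t) >= q g + q h t,
    and q h >= d pays for it; this also gives the constant c = - q g. Both are uniform in [m]. *)
Lemma young_term_gamma (d : nat) : exists (q : nat) (c : R),
  forall m a b y, (0 < m)%N -> (mlength b <= mlength a + d)%N ->
  young_term w m a = y%:E -> (young_term w (m + q) b <= (y + c)%:E)%E.
Proof.
have [g [h [h0 gamma]]] := weight_gamma Hw.
pose q := (Num.truncn (d%:R / h)).+1.
have qh : d%:R <= q%:R * h by rewrite -ler_pdivrMr// ltW// truncnS_gt.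
exists q, (q%:R * - g) => m a b y m0 ba ya.
apply: young_term_le => [|t t0]; first by rewrite addn_gt0 m0.
have := young_term_ge a m0 t0; rewrite ya lee_fin natrD => hy.
have lt : t <= ln (1 + expR t).
  by rewrite -[leLHS]expRK ler_ln ?posrE ?expR_gt0 ?addr_gt0 ?expR_gt0// lerDr.
have gt : g + h * t <= w (expR t).
  by apply: le_trans (gamma _ (expR_ge0 _)); rewrite lerD2l ler_wpM2l// ltW.
have h1 : (mlength b)%:R * t <= ((mlength a)%:R + d%:R) * t.
  by rewrite ler_wpM2r// -natrD ler_nat.
have h2 : d%:R * t <= q%:R * h * t by rewrite ler_wpM2r.
have h3 : q%:R * (g + h * t) <= q%:R * w (expR t) by rewrite ler_wpM2l.
nra.
Qed.

End YoungTerm.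

(** * Summability of 2^-|a| over the multi-indices *)

Section GeometricSum.
Context {R : realType} {N : nat}.
Local Notation mindex := {ffun 'I_N -> nat}.

Lemma geometric_half (M : nat) : \sum_(j < M) (2^-1 : R) ^+ j = 2 - 2 * 2^-1 ^+ M.
Proof.
elim: M => [|M IH]; first by rewrite big_ord0 expr0 mulr1 subrr.
by rewrite big_ord_recr /= IH exprS; lra.
Qed.

(** Finitely many multi-indices lie in a box, over which the sum factors into [N] geometric sums,
    each at most 2. [low] and [up] recode the box as a finite type so that [bigA_distr_bigA]
    applies. *)
Lemma sum_geometric_seq (X : seq mindex) : uniq X ->
  \sum_(a <- X) (2^-1 : R) ^+ mlength a <= 2 ^+ N.
Proof.
move=> uX; pose M := (\max_(a <- X) \max_i a i)%N.
have leM a i : a \in X -> (a i < M.+1)%N.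
  move=> aX; rewrite ltnS; apply: (@leq_trans (\max_i a i)%N).
    by rewrite (bigD1 i)//= leq_maxl.
  by rewrite /M (big_rem a)//= leq_maxl.
pose low (a : mindex) : {ffun 'I_N -> 'I_M.+1} := [ffun i => inord (a i)].
pose up (y : {ffun 'I_N -> 'I_M.+1}) : mindex := [ffun i => y i : nat].
have lowK : {in X, cancel low up}.
  by move=> a aX; apply/ffunP => i; rewrite !ffunE inordK// leM.
have -> : \sum_(a <- X) (2^-1 : R) ^+ mlength a =
    \sum_(y <- map low X) 2^-1 ^+ mlength (up y).
  by rewrite big_map; apply: eq_big_seq => a aX; rewrite lowK.
rewrite big_uniq /=; last by rewrite map_inj_in_uniq//; exact: can_in_inj lowK.
apply: (@le_trans _ _ (\sum_(y : {ffun 'I_N -> 'I_M.+1}) 2^-1 ^+ mlength (up y))).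
  rewrite [leRHS](bigID (mem (map low X)))/= lerDl sumr_ge0//.
rewrite [leLHS](_ : _ = \prod_(i < N) \sum_(j < M.+1) (2^-1 : R) ^+ j); last first.
  rewrite bigA_distr_bigA/=; apply: eq_bigr => y _.
  rewrite /mlength expr_sum; apply: eq_bigr => i _.
  by rewrite ffunE.
rewrite prodr_const card_ord lerXn2r ?nnegrE//.
  by apply: sumr_ge0 => j _; rewrite exprn_ge0// invr_ge0.
by rewrite geometric_half gerBl mulr_ge0// exprn_ge0// invr_ge0.
Qed.

Lemma esum_geometricZ (c : R) : 0 <= c ->
  (\esum_(a in [set: mindex]) (c * (2^-1 : R) ^+ mlength a)%:E <= (c * 2 ^+ N)%:E)%E.
Proof.
move=> c0; apply: ge_ereal_sup => _ [A [fA _] <-].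
rewrite fsbig_finite//= sumEFin lee_fin -mulr_sumr ler_wpM2l//.
by rewrite sum_geometric_seq// finmap.fset_uniq.
Qed.

End GeometricSum.

(** * Norm estimates *)

Lemma continuous_mul {R : realType} {V : topologicalType} (u v : V -> R) :
  continuous u -> continuous v -> continuous (fun x => u x * v x).
Proof. by move=> cu cv x; apply: cvgM; [exact: cu|exact: cv]. Qed.

Lemma powR_ge1 {R : realType} (x p : R) : 1 <= p -> 1 <= x -> x <= x `^ p.
Proof.
by move=> p1 x1; rewrite -[leLHS]powRr1 ?(le_trans ler01)// ler_powR.
Qed.

(* Replaces Jensen's inequality on the unit cube: with [M] the L^p norm of [u], the
   right-hand side integrates to [2 M]. *)
Lemma le_affine_powR {R : realType} (u M p : R) : 1 <= p -> 0 <= u -> 0 < M ->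
  u <= M + M * (M `^ p)^-1 * u `^ p.
Proof.
move=> p1 u0 M0; have [uM|Mu] := leP u M.
  by rewrite (le_trans uM)// lerDl !mulr_ge0 ?invr_ge0 ?powR_ge0// ltW.
have Mp : 0 < M `^ p by rewrite powR_gt0.
have e : (u / M) `^ p = u `^ p / M `^ p.
  apply: (mulIf (x := M `^ p)); first by rewrite gt_eqF.
  by rewrite divfK ?gt_eqF// -powRM ?divfK ?gt_eqF// ?divr_ge0// ltW.
have -> : M * (M `^ p)^-1 * u `^ p = M * (u / M) `^ p by rewrite e; ring.
have h : u / M <= (u / M) `^ p.
  by apply: powR_ge1 => //; rewrite ler_pdivlMr// mul1r ltW.
by move: h; rewrite ler_pdivrMr// mulrC => h; rewrite (le_trans h)// lerDr ltW.
Qed.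

Section NormEstimates.
Context {R : realType} {N : nat} (w : R -> R) (p : R).
Hypothesis Hw : nonquasianalytic_weight w.
Hypothesis p1 : 1 <= p.
Local Notation mR := (measurableTypeR R).
Local Notation E := 'rV[R]_N.
Implicit Types (a : {ffun 'I_N -> nat}) (m k : nat) (n : int) (f : E -> R[i]) (rho y : R).

Let p0 : 0 < p. Proof. exact: lt_le_trans p1. Qed.

(** Only indices with a finite Young term need a check: for the others the weight is exp (-oo) = 0
    and the term is 0. *)
Lemma rnorm_le m n f rho : (0 < m)%N -> 0 <= rho ->
  (forall a x y, young_term w m a = y%:E ->
    modulus (mpartial a f x) * expR (- (n%:~R * w (enorm x)) - y) <= rho) ->
  (rnorm w m n f <= rho%:E)%E.
Proof.
move=> m0 rho0 h; apply: ge_ereal_sup => _ [[a x] _ <-] /=.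
have := young_term_ge0 Hw a m0; case ya : (young_term w m a) => [y| |]// _.
  by rewrite -EFinN -EFinD /= -EFinM lee_fin; exact: h.
by rewrite /= mule0.
Qed.

Lemma rnorm_term m n f rho a x y : (rnorm w m n f <= rho%:E)%E ->
  young_term w m a = y%:E ->
  modulus (mpartial a f x) * expR (- (n%:~R * w (enorm x)) - y) <= rho.
Proof.
move=> h ya; rewrite -lee_fin; apply: le_trans h.
by apply: ereal_sup_ubound; exists (a, x) => //=; rewrite ya.
Qed.

Lemma weighted_partial_ge0 n a f x : 0 <= weighted_partial w n a f x.
Proof. by rewrite mulr_ge0 ?expR_ge0// modulus_ge0. Qed.

Lemma continuous_weighted_partial n a f : smooth f ->
  continuous (weighted_partial w n a f).
Proof.
move=> sf; apply: continuous_mul; first exact: continuous_expweight.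
exact: smooth_continuous_modulus.
Qed.

Lemma measurable_weighted_partial n a f : smooth f ->
  measurable_fun [set: N.-tuple mR] (fun t : N.-tuple mR => weighted_partial w n a f (row_of t)).
Proof.
move=> sf; apply: (measurable_row_of (g := weighted_partial w n a f)).
exact: continuous_weighted_partial.
Qed.

Lemma measurable_weighted_powR n a f : smooth f ->
  measurable_fun [set: N.-tuple mR]
    (fun t : N.-tuple mR => (weighted_partial w n a f (row_of t) `^ p)%:E).
Proof.
move=> sf; apply/measurable_EFinP.
exact: (measurableT_comp (measurable_powR p) (measurable_weighted_partial n a sf)).
Qed.

Definition pintegral n a f : \bar R :=
  (\int[lebesgue_tuple N]_t (weighted_partial w n a f (row_of t) `^ p)%:E)%E.

Lemma pintegral_ge0 n a f : (0 <= pintegral n a f)%E.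
Proof. by apply: integral_ge0 => t _; rewrite lee_fin powR_ge0. Qed.

Lemma poweR_Lpnorm n a f : poweR (Lpnorm p (weighted_partial w n a f)) p = pintegral n a f.
Proof.
have pn0 : p != 0 by rewrite gt_eqF.
rewrite [LHS](poweR_Lnorm _ _ pn0); apply: eq_integral => t _.
by rewrite abse_EFin poweR_EFin ger0_norm// weighted_partial_ge0.
Qed.

Definition rpsum m n f : \bar R :=
  (\esum_(a in [set: {ffun 'I_N -> nat}])
     (pintegral n a f * expeR (- (p%:E * young_term w m a))))%E.

Lemma rpsum_term_ge0 m n f a :
  (0 <= pintegral n a f * expeR (- (p%:E * young_term w m a)))%E.
Proof. by rewrite mule_ge0 ?pintegral_ge0 ?expeR_ge0. Qed.

Lemma rpnormE m n f : rpnorm w m n p f = poweR (rpsum m n f) p^-1.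
Proof.
rewrite /rpnorm /rpsum; congr (poweR _ _); apply: eq_esum => a _.
by rewrite poweR_Lpnorm.
Qed.

(** Lets the estimates work with sums of plain integrals, without roots. *)
Lemma rpnorm_leP m n f rho : 0 <= rho ->
  (rpnorm w m n p f <= rho%:E)%E <-> (rpsum m n f <= (rho `^ p)%:E)%E.
Proof.
move=> rho0; rewrite rpnormE.
have s0 : (0 <= rpsum m n f)%E by apply: esum_ge0 => a _; exact: rpsum_term_ge0.
have pV : p * p^-1 = 1 by rewrite divff// gt_eqF.
split=> h.
- rewrite -[leLHS]poweRe1// -(mulVf (x := p)) ?gt_eqF// poweRrM -poweR_EFin.
  apply: gt0_ler_poweR => //; first exact: ltW.
  + by rewrite in_itv/= poweR_ge0 leey.
  + by rewrite in_itv/= lee_fin rho0 leey.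
- rewrite -[leRHS]poweRe1 ?lee_fin// -pV poweRrM poweR_EFin.
  apply: gt0_ler_poweR => //; first by rewrite invr_ge0 ltW.
  + by rewrite in_itv/= s0 leey.
  + by rewrite in_itv/= lee_fin powR_ge0 leey.
Qed.

Lemma rpnorm_term m n f rho a y : 0 <= rho -> (rpnorm w m n p f <= rho%:E)%E ->
  young_term w m a = y%:E -> (pintegral n a f <= ((rho * expR y) `^ p)%:E)%E.
Proof.
move=> rho0 /(rpnorm_leP _ _ _ rho0) h ya.
have : (pintegral n a f * expeR (- (p%:E * young_term w m a)) <= (rho `^ p)%:E)%E.
  apply: le_trans h; apply: esum_ge; exists [set a]; last by rewrite fsbig_set1.
  by split; [exact: finite_set1|].
rewrite ya -EFinM -EFinN /= expRN lee_pdivrMr ?expR_gt0//.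
by rewrite -EFinM powRM ?expR_ge0// [p * y]mulrC expRM.
Qed.

End NormEstimates.

(** * From the sup norms to the L^p norms *)

Section EstimateA.
Context {R : realType} {N : nat} (w : R -> R) (p : R).
Hypothesis Hw : nonquasianalytic_weight w.
Hypothesis p1 : 1 <= p.
Implicit Types (m k : nat) (n : int) (f : 'rV[R]_N -> R[i]) (rho : R).

Lemma rpnorm_le_rnorm : exists k, exists2 l : nat, (0 < l)%N &
  forall m, (0 < m)%N -> exists2 C : R, 0 < C &
    forall n f rho, 0 < rho -> smooth f ->
      (rnorm w (m * l) n f <= rho%:E)%E ->
      (rpnorm w m (n + k%:Z) p f <= (C * rho)%:E)%E.
Proof.
have pgt0 : 0 < p := lt_le_trans ltr01 p1.
have p0 := ltW pgt0.
have [k intk] := weight_integral_lt_pinfty (N := N) Hw.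
have [l l0 alpha] := young_term_alpha (N := N) Hw.
set I := (\int[lebesgue_tuple N]_t _)%E in intk.
have I0 : (0 <= I)%E by apply: integral_ge0 => t _; rewrite lee_fin expR_ge0.
pose J := fine I; have IE : I = J%:E by rewrite fineK// ge0_fin_numE.
have J0 : 0 <= J by rewrite -lee_fin -IE.
exists k, l => // m m0; have [c young] := alpha m m0.
(* [J] comes from the integral of exp (- k w), 2^N from the sum over the multi-indices. Adding 1
   makes the bracket at least 1, so that its p-th power still dominates J 2^N. *)
exists (expR c * (J * 2 ^+ N + 1)) => [|n f rho rho0 sf hf].
  by rewrite mulr_gt0 ?expR_gt0// ltr_wpDl// mulr_ge0// exprn_ge0.
have rho0' := ltW rho0.
have C0 : 0 <= J * 2 ^+ N + 1 by rewrite addr_ge0// mulr_ge0// exprn_ge0.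
have Crho0 : 0 <= expR c * (J * 2 ^+ N + 1) * rho.
  by rewrite !mulr_ge0 ?expR_ge0.
apply/(rpnorm_leP _ p1 _ _ _ Crho0).
apply: (@le_trans _ _ (\esum_(a in [set: {ffun 'I_N -> nat}])
    ((rho * expR c) `^ p * J * 2^-1 ^+ mlength a)%:E)%E); last first.
  apply: le_trans (esum_geometricZ _) _.
    by rewrite mulr_ge0// powR_ge0.
  rewrite lee_fin [X in _ <= X `^ p](_ : _ = (rho * expR c) * (J * 2 ^+ N + 1));
    last by ring.
  rewrite -mulrA [leRHS]powRM ?mulr_ge0 ?expR_ge0// ler_wpM2l ?powR_ge0//.
  apply: le_trans (powR_ge1 p1 _); first by rewrite lerDl.
  by rewrite lerDr mulr_ge0// exprn_ge0.
apply: le_esum => a _.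
have := young_term_ge0 Hw a m0; case ya : (young_term w m a) => [y| |]// _; last first.
  by rewrite gt0_muley ?lte_fin//= mule0 lee_fin !mulr_ge0 ?powR_ge0 ?exprn_ge0 ?invr_ge0.
have ml0 : (0 < m * l)%N by rewrite muln_gt0 m0.
have := young_term_ge0 Hw a ml0; have := young a y ya.
case yl : (young_term w (m * l) a) => [y'| |]// y'y _; rewrite lee_fin in y'y.
(* The extra [k] in the index leaves a factor exp (- k w); its p-th power is at most itself since w
   >= 0 and p >= 1, so one [k] serves every [p]. *)
have pt t : weighted_partial w (n + k%:Z) a f (row_of t) `^ p <=
    (rho * expR y') `^ p * expR (- (k%:R * w (enorm (row_of t)))).
  have := rnorm_term (row_of t) hf yl; set x := row_of t => hx.
  have wx0 : 0 <= w (enorm x) by apply: (weight_ge0 Hw); exact: enorm_ge0.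
  have kwx0 : 0 <= k%:R * w (enorm x) by rewrite mulr_ge0.
  apply: (@le_trans _ _ ((rho * expR y' * expR (- (k%:R * w (enorm x)))) `^ p)).
    rewrite ge0_ler_powR ?nnegrE ?weighted_partial_ge0 ?mulr_ge0 ?expR_ge0//.
    rewrite /weighted_partial intrD mulrDl opprD expRD mulrAC ler_wpM2r ?expR_ge0//.
    rewrite mulrC -ler_pdivrMr ?expR_gt0// -mulrA -expRN -expRD.
    exact: hx.
  rewrite powRM ?mulr_ge0 ?expR_ge0// ler_wpM2l ?powR_ge0//.
  by rewrite -expRM ler_expR mulNr lerN2 ler_peMr.
have intle : (pintegral w p (n + k%:Z) a f <= ((rho * expR y') `^ p * J)%:E)%E.
  rewrite EFinM -IE -ge0_integralZl_EFin ?powR_ge0//; last first.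
    apply/measurable_EFinP.
    apply: (measurable_row_of (g := fun x => expR (- (k%:R * w (enorm x))))).
    exact: continuous_expweight.
  apply: ge0_le_integral => //.
  - by move=> t _; rewrite lee_fin powR_ge0.
  - exact: measurable_weighted_powR.
  - apply: measurable_funeM; apply/measurable_EFinP.
    apply: (measurable_row_of (g := fun x => expR (- (k%:R * w (enorm x))))).
    exact: continuous_expweight.
  - by move=> t _; rewrite -EFinM lee_fin; exact: pt.
rewrite -EFinM -EFinN /=.
apply: (le_trans (lee_wpmul2r _ intle)); first by rewrite lee_fin expR_ge0.
rewrite -EFinM lee_fin [leLHS](mulrAC _ J) [leRHS](mulrAC _ J).
apply: (ler_wpM2r J0).
rewrite -mulrN [p * _]mulrC expRM -powRM ?mulr_ge0 ?expR_ge0//.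
have d0 : 0 <= (mlength a)%:R * ln 2 :> R by rewrite mulr_ge0// ln_ge0// ler1n.
apply: (@le_trans _ _ ((rho * expR c * expR (- ((mlength a)%:R * ln 2))) `^ p)).
  rewrite ge0_ler_powR ?nnegrE ?mulr_ge0 ?expR_ge0//.
  by rewrite -!mulrA -!expRD ler_pM2l// ler_expR; lra.
rewrite powRM ?mulr_ge0 ?expR_ge0// ler_wpM2l ?powR_ge0// -expRM mulNr.
(* Again p >= 1 allows the exponent to be dropped: 2^(- p |a|) <= 2^(-|a|). *)
rewrite (@le_trans _ _ (expR (- ((mlength a)%:R * ln 2))))//.
  by rewrite ler_expR lerN2 ler_peMr.
by rewrite expRN expRM_natl lnK ?posrE// exprVn.
Qed.

End EstimateA.

(** * From the L^p norms to the sup norms *)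

Section EstimateB.
Context {R : realType} {N : nat} (w : R -> R) (p : R).
Hypothesis Hw : nonquasianalytic_weight w.
Hypothesis p1 : 1 <= p.
Local Notation mR := (measurableTypeR R).
Local Notation E := 'rV[R]_N.
Implicit Types (m k : nat) (n : int) (f : E -> R[i]) (rho : R).

Lemma cube_eq0 (x t : N.-tuple R) :
  ~ (forall i, tnth x i <= tnth t i <= tnth x i + 1) -> cube x t = 0.
Proof.
move=> /existsNP[i xti]; rewrite /cube (bigD1 i)//= indicE memNset ?mul0r//=.
Qed.

Lemma cube_le1 (x t : N.-tuple R) : cube x t <= 1.
Proof.
by apply: prodr_ile1 => i _; rewrite indicE; case: (_ \in _); rewrite /= ?lexx ?ler01.
Qed.

(** Coordinatewise y_i^2 <= 2 x_i^2 + 2, and summation gives 2 |x|^2 + 2 N. The bound is put in the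
    form 2 max so that (alpha) applies to it directly. *)
Lemma enorm_cube (x y : E) : (forall i, x ord0 i <= y ord0 i <= x ord0 i + 1) ->
  enorm y <= 2 * Num.max (enorm x) (Num.sqrt N%:R).
Proof.
move=> xy; set M := Num.max _ _.
have M0 : 0 <= M by rewrite le_max enorm_ge0.
rewrite -[leLHS]ger0_norm ?enorm_ge0// -[leRHS]ger0_norm ?mulr_ge0//.
rewrite -ler_sqr ?nnegrE// !real_normK ?num_real// exprMn sqr_enorm.
have hx : enorm x ^+ 2 <= M ^+ 2 by rewrite ler_pXn2r ?nnegrE ?enorm_ge0// le_max lexx.
have hN : N%:R <= M ^+ 2.
  rewrite -[leLHS]sqr_sqrtr ?ler0n// ler_pXn2r ?nnegrE ?sqrtr_ge0//.
  by rewrite le_max lexx orbT.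
apply: (@le_trans _ _ (2 * enorm x ^+ 2 + 2 * N%:R)); last by lra.
rewrite sqr_enorm mulr_sumr -[N in 2 * N%:R]card_ord -sum1_card natr_sum mulr_sumr.
rewrite -big_split/= ler_sum// => i _.
have /andP[h1 h2] := xy i.
(* With d = y_i - x_i in [0, 1], 2 x_i^2 + 2 - y_i^2 = (2 x_i - y_i)^2 + 2 (1 - d^2), and 1 - d^2 =
   (1 - d) + d (1 - d). *)
have h3 := sqr_ge0 (2 * x ord0 i - y ord0 i).
have h4 : 0 <= (y ord0 i - x ord0 i) * (x ord0 i + 1 - y ord0 i).
  by rewrite mulr_ge0// subr_ge0.
by move: h1 h2 h3 h4; rewrite !expr2; nra.
Qed.

(** Apply (alpha) to the bound of [enorm_cube], then bound [w] of the maximum by the sum of the two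
    values. The constant of (alpha) is rounded up because it will multiply the integer index [n]. *)
Lemma weight_cube : exists (k : nat) (c : R), (0 < k)%N /\ forall x y : E,
  (forall i, x ord0 i <= y ord0 i <= x ord0 i + 1) ->
  w (enorm y) <= k%:R * w (enorm x) + c.
Proof.
have [K0 K1 alpha] := weight_alpha Hw.
pose k := (Num.truncn K0).+1.
have K0k : K0 <= k%:R by rewrite ltW// truncnS_gt.
pose r := Num.sqrt N%:R : R.
have r0 : 0 <= r := sqrtr_ge0 _.
exists k, (k%:R * (1 + w r)); split=> // x y /enorm_cube.
set M := Num.max _ _ => yM.
have M0 : 0 <= M by rewrite le_max enorm_ge0.
have wx0 : 0 <= w (enorm x) by apply: (weight_ge0 Hw); exact: enorm_ge0.
have wr0 : 0 <= w r by exact: (weight_ge0 Hw).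
have wM : w M <= w (enorm x) + w r.
  by rewrite /M maxEle; case: ifP => _; rewrite ?lerDl ?lerDr.
have h1 : w (enorm y) <= w (2 * M).
  by apply: (weight_nondecreasing Hw) => //; exact: enorm_ge0.
apply: (le_trans h1); apply: (le_trans (alpha _ M0)).
apply: (@le_trans _ _ (k%:R * (1 + w M))).
  by rewrite ler_wpM2r// addr_ge0// (weight_ge0 Hw).
by rewrite -mulrDr ler_wpM2l// addrCA lerD2l.
Qed.

(** Removing the weight on the cube costs the exponential factor. In the affine bound of
    [le_affine_powR] the constant part integrates to [M], since the cube has volume 1, and the power
    part to at most [M]; hence 2 M. *)
Lemma integral_cube_modulus (k n : nat) (c M : R) a f (x : E) : smooth f -> 0 < M ->
  (forall y : E, (forall i, x ord0 i <= y ord0 i <= x ord0 i + 1) ->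
    w (enorm y) <= k%:R * w (enorm x) + c) ->
  (pintegral w p n a f <= (M `^ p)%:E)%E ->
  (\int[lebesgue_tuple N]_(t in setT)
     (cube (tuple_of x) t * modulus (mpartial a f (row_of t)))%:E <=
   (expR (n%:R * (k%:R * w (enorm x) + c)) * (2 * M))%:E)%E.
Proof.
move=> sf M0 wcube fM; set e := expR _.
have M0' := ltW M0.
have e0 : 0 <= e := expR_ge0 _.
pose B := M * (M `^ p)^-1.
have Mp : 0 < M `^ p by rewrite powR_gt0.
have B0 : 0 <= B by rewrite mulr_ge0// invr_ge0 ltW.
pose g (t : N.-tuple mR) := weighted_partial w n a f (row_of t) `^ p.
have g0 t : 0 <= g t := powR_ge0 _ _.
have mg : measurable_fun [set: N.-tuple mR] (fun t => (g t)%:E).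
  exact: measurable_weighted_powR.
have mc : measurable_fun [set: N.-tuple mR] (fun t => (cube (tuple_of x) t)%:E).
  by apply/measurable_EFinP; exact: measurable_cube.
(* The indicator is kept on the constant part, which would not be integrable otherwise, and dropped
   from [g], whose integral over the whole space is controlled by [fM]. *)
have pt t : cube (tuple_of x) t * modulus (mpartial a f (row_of t)) <=
    e * (M * cube (tuple_of x) t + B * g t).
  have [box|nbox] := pselect
      (forall i, tnth (tuple_of x) i <= tnth t i <= tnth (tuple_of x) i + 1); last first.
    rewrite cube_eq0// mul0r mulr0 add0r; exact: mulr_ge0 e0 (mulr_ge0 B0 (g0 t)).
  have wt : w (enorm (row_of t)) <= k%:R * w (enorm x) + c.
    by apply: wcube => i; have := box i; rewrite tnth_mktuple mxE.
  have ge := weighted_partial_ge0 w n a f (row_of t).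
  have mle : modulus (mpartial a f (row_of t)) <= e * weighted_partial w n a f (row_of t).
    rewrite /weighted_partial mulrA -expRD ler_peMl ?modulus_ge0// -[leLHS]expR0 ler_expR.
    by rewrite subr_ge0 -pmulrn ler_wpM2l.
  have c0 := cube_ge0 (tuple_of x) t.
  have c1 := cube_le1 (tuple_of x) t.
  have gle := le_affine_powR p1 ge M0; rewrite -/B -/(g t) in gle.
  rewrite (le_trans (ler_wpM2l c0 mle))// mulrCA ler_wpM2l//.
  rewrite (le_trans (ler_wpM2l c0 gle))// mulrDr [M * _]mulrC lerD2l.
  by rewrite ler_piMl// mulr_ge0.
apply: (@le_trans _ _ (\int[lebesgue_tuple N]_(t in setT)
    (e%:E * (M%:E * (cube (tuple_of x) t)%:E + B%:E * (g t)%:E)))%E).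
  apply: ge0_le_integral => //.
  - by move=> t _; rewrite lee_fin mulr_ge0 ?cube_ge0// modulus_ge0.
  - apply/measurable_EFinP; apply: measurable_funM; first exact: measurable_cube.
    apply: (measurable_row_of (g := fun y => modulus (mpartial a f y))).
    exact: smooth_continuous_modulus.
  - by apply: measurable_funeM; apply: emeasurable_funD; exact: measurable_funeM.
  - by move=> t _; exact: pt.
rewrite ge0_integralZl_EFin//; last 2 first.
- move=> t _; rewrite adde_ge0// mule_ge0// lee_fin//.
  exact: cube_ge0.
- by apply: emeasurable_funD; exact: measurable_funeM.
rewrite [leRHS]EFinM lee_wpmul2l ?lee_fin//.
rewrite ge0_integralD//; last 4 first.
- by move=> t _; rewrite mule_ge0// lee_fin// cube_ge0.
- exact: measurable_funeM.
- by move=> t _; rewrite mule_ge0// lee_fin.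
- exact: measurable_funeM.
rewrite !ge0_integralZl_EFin//; last 2 first.
- by move=> t _; rewrite lee_fin.
- by move=> t _; rewrite lee_fin cube_ge0.
rewrite integral_cube mule1.
apply: (le_trans (leeD2l _ (lee_wpmul2l _ fM))); first by rewrite lee_fin.
by rewrite -EFinM -EFinD lee_fin /B divfK ?gt_eqF//; lra.
Qed.

Lemma component_bound (P : (E -> R[i]) -> E -> R) a f x (D : R) : smooth f ->
  (forall s, continuous (P (partials s f))) ->
  (forall g y, `|P g y| <= modulus (g y)) ->
  (`|P (mpartial a f) x|%:E <= \sum_(b : N.-tuple bool) \int[lebesgue_tuple N]_t
     (cube (tuple_of x) t * `|P (mpartial (incr a b) f) (row_of t)|)%:E)%E ->
  (forall b : N.-tuple bool, (\int[lebesgue_tuple N]_(t in setT)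
     (cube (tuple_of x) t * modulus (mpartial (incr a b) f (row_of t)))%:E <= D%:E)%E) ->
  `|P (mpartial a f) x| <= 2 ^+ N * D.
Proof.
move=> sf cP Pmod sob bD; rewrite -lee_fin; apply: (le_trans sob).
apply: (@le_trans _ _ (\sum_(b : N.-tuple bool) D%:E)%E).
  apply: lee_sum => b _; apply: le_trans (bD b).
  have mrow (g : E -> R) : continuous g ->
      measurable_fun [set: N.-tuple mR] (fun t : N.-tuple mR => g (row_of t)).
    exact: measurable_row_of.
  apply: ge0_le_integral => //.
  - by move=> t _; rewrite lee_fin mulr_ge0 ?cube_ge0.
  - by apply: measurable_cube_abs; apply: mrow; exact: cP.
  - apply/measurable_EFinP; apply: measurable_funM; first exact: measurable_cube.
    apply: (mrow (fun y => modulus (mpartial (incr a b) f y))).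
    exact: smooth_continuous_modulus.
  - by move=> t _; rewrite lee_fin ler_wpM2l ?cube_ge0.
rewrite sumEFin lee_fin sumr_const card_tuple card_bool.
by rewrite -natrX mulr_natl.
Qed.

Lemma rnorm_le_rpnorm : exists2 k : nat, (0 < k)%N &
  forall m, (0 < m)%N -> exists q : nat, forall n : nat, exists2 C : R, 0 < C &
    forall f rho, 0 < rho -> smooth f ->
      (rpnorm w (m + q) n p f <= rho%:E)%E ->
      (rnorm w m (k * n)%N f <= (C * rho)%:E)%E.
Proof.
have [k [c0 [k0 wc]]] := weight_cube; exists k => // m m0.
have [q [c young]] := young_term_gamma (N := N) Hw N; exists q => n.
(* Factors: 2 for real and imaginary part, 2^N for the sum over [b], 2 from [integral_cube_modulus],
   and the exponential for the additive constants of [weight_cube] and [young_term_gamma]. *)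
exists (2 * (2 ^+ N * (2 * expR (n%:R * c0 + c)))) => [|f rho rho0 sf hf].
  by rewrite !mulr_gt0 ?expR_gt0 ?exprn_gt0.
have rho0' := ltW rho0.
have mq0 : (0 < m + q)%N by rewrite addn_gt0 m0.
have pge0 : 0 <= p := le_trans ler01 p1.
apply: (rnorm_le Hw) => // [|a x y ya].
  by rewrite !mulr_ge0 ?expR_ge0// exprn_ge0.
pose M := rho * expR (y + c).
have M0 : 0 < M by rewrite mulr_gt0 ?expR_gt0.
have fM b : (pintegral w p n (incr a b) f <= (M `^ p)%:E)%E.
  have := young m a (incr a b) y m0 (mlength_incr a b) ya.
  have := young_term_ge0 Hw (incr a b) mq0.
  case yb : (young_term w (m + q) (incr a b)) => [y'| |]// _; rewrite lee_fin => y'y.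
  apply: le_trans (rpnorm_term p1 rho0' hf yb) _.
  rewrite lee_fin ge0_ler_powR ?nnegrE ?mulr_ge0 ?expR_ge0//.
  by rewrite ler_wpM2l// ler_expR.
have bD b := integral_cube_modulus sf M0 (wc x) (fM b).
set D := expR _ * _ in bD.
have hre : `|re_part (mpartial a f) x| <= 2 ^+ N * D.
  apply: (component_bound (P := @re_part R N) sf) => //.
  - by move=> s; have [] := sf s.
  - by move=> g z; exact: modulus_ge_Re.
  - exact: re_sobolev.
have him : `|im_part (mpartial a f) x| <= 2 ^+ N * D.
  apply: (component_bound (P := @im_part R N) sf) => //.
  - by move=> s; have [] := sf s.
  - by move=> g z; exact: modulus_ge_Im.
  - exact: im_sobolev.
set e := expR (- _ - y).
have hm : modulus (mpartial a f x) <= 2 * (2 ^+ N * D).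
  apply: le_trans (modulus_le _) _.
  by rewrite [leRHS]mulr_natl mulr2n lerD.
rewrite (le_trans (ler_wpM2r (expR_ge0 _) hm))//.
rewrite le_eqVlt; apply/orP; left; apply/eqP.
(* The terms k n w x and y cancel between the bound and the weight [e], which leaves a constant
   independent of [x] and [a]. *)
have -> : expR (n%:R * c0 + c) =
    expR (n%:R * (k%:R * w (enorm x) + c0)) * expR (y + c) * e.
  rewrite /e -!expRD; congr expR; rewrite -pmulrn natrM; ring.
by rewrite /D /M -/e; ring.
Qed.

End EstimateB.

(** * Comparison of limits *)

Section LimitComparison.
Context {K : numFieldType} {E : lmodType K}.
Implicit Types (X Y : @topsub K E) (P : set E) (tau : set (set E)).

Definition cont_incl X Y : Prop :=
  carrier X `<=` carrier Y /\
  forall V, opens Y V -> opens X (V `&` carrier X).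

Definition subspace P : Prop :=
  forall (a : K) x y, P x -> P y -> P (a *: x + y).

Lemma subspaceD P x y : subspace P -> P x -> P y -> P (x + y).
Proof. by move=> sP Px Py; rewrite -(scale1r x); exact: sP. Qed.

Lemma subspaceZ P (a : K) x : subspace P -> P x -> P (a *: x).
Proof.
move=> sP Px; have P0 : P 0 by rewrite -(subrr x) addrC -scaleN1r; exact: sP.
by rewrite -[_ *: _]addr0; exact: sP.
Qed.

(* The final topology of the inclusion of [P] into [Q]. *)
Lemma topology_on_extend P Q tau : P `<=` Q -> topology_on P tau ->
  topology_on Q [set V | V `<=` Q /\ tau (V `&` P)].
Proof.
move=> PQ [_ tP tI tU]; split=> /= [U []//||U V [UQ tU'] [VQ tV]|F FQ].
- by split=> //; rewrite setIidr.
- by split; [move=> x [/UQ]|rewrite setIIl; exact: tI].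
- split; first by move=> x [U /FQ[UQ _]] /UQ.
  rewrite setI_bigcupl.
  rewrite (_ : \bigcup_(_ in _) _ = \bigcup_(U in [set U `&` P | U in F]) U).
    by apply: tU => _ [U /FQ[_ tU'] <-].
  by rewrite bigcup_image.
Qed.

(** For each topology [tau] on [P] that contains [G], the sets V of [Q] whose trace on [P] is in
    [tau] form a topology; if it contains [H], it contains all that [H] generates. So continuity can
    be tested on generators. *)
Lemma smallest_topology_cont P Q (G H : set (set E)) : P `<=` Q ->
  (forall V, H V -> V `<=` Q /\ forall tau, topology_on P tau -> G `<=` tau ->
     tau (V `&` P)) ->
  forall V, smallest (topology_on Q) H V -> smallest (topology_on P) G (V `&` P).
Proof.
move=> PQ HG V sV tau [tauP Gtau].
have [] // := sV [set V | V `<=` Q /\ tau (V `&` P)].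
by split; [exact: topology_on_extend|move=> U /HG[UQ h]; split=> //; exact: h].
Qed.

(** The power set of [P] is one of the topologies intersected by [smallest]. *)
Lemma smallest_topology_sub P (G : set (set E)) V :
  G `<=` [set U | U `<=` P] -> smallest (topology_on P) G V -> V `<=` P.
Proof.
move=> GP /(_ [set U | U `<=` P]); apply; split=> //; split=> //=.
- by move=> A B AP _ x [/AP].
- by move=> F FP x [U /FP UP /UP].
Qed.

Lemma proj_lim_cont (I J : Type) (X : I -> @topsub K E) (Y : J -> @topsub K E) :
  (forall j, exists i, cont_incl (X i) (Y j)) ->
  cont_incl (proj_lim X) (proj_lim Y).
Proof.
move=> XY; have PQ : carrier (proj_lim X) `<=` carrier (proj_lim Y).
  by move=> f /= Xf j _; have [i [XYi _]] := XY j; apply: XYi; exact: Xf.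
split=> //; apply: smallest_topology_cont => // _ [j [V [oV ->]]].
split; first by move=> ? [].
move=> tau _; apply; have [i [Xi op]] := XY j.
exists i, (V `&` carrier (X i)); split; first exact: op.
apply/seteqP; split=> x [].
- by case=> Vx _ Px; split=> //; split=> //; exact: Px.
- by case=> Vx _ Px; split=> //; split=> //; exact: PQ.
Qed.

Lemma proj_lim_opens_sub (I : Type) (X : I -> @topsub K E) V :
  opens (proj_lim X) V -> V `<=` carrier (proj_lim X).
Proof.
by apply: smallest_topology_sub => _ [i [U [_ ->]]] x [].
Qed.

Lemma ind_lim_opens_sub (I : Type) (X : I -> @topsub K E) V :
  opens (ind_lim X) V -> V `<=` carrier (ind_lim X).
Proof.
apply: smallest_topology_sub => U [tau [[[h _ _ _] _ _ _] _]].
exact: h.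
Qed.

Lemma convex_setI_subspace P (V : set E) : subspace P ->
  convex_set (V : set (convex_lmodType E)) ->
  convex_set ((V `&` P) : set (convex_lmodType E)).
Proof.
move=> sP cV x y l; rewrite !inE => -[Vx Px] [Vy Py]; split.
- by have := cV x y l; rewrite !inE; exact.
- have : P (l%:inum *: (x : E) + (1 - l%:inum) *: (y : E)).
    by exact: (sP _ _ _ Px (subspaceZ _ sP Py)).
  exact.
Qed.

(** Linearity of [P] keeps sums, multiples and convex combinations in [P] when neighbourhoods are
    cut down to it. *)
Lemma lc_topology_subspace P Q tau : P `<=` Q -> subspace P ->
  lc_topology Q tau -> lc_topology P [set V `&` P | V in tau].
Proof.
move=> PQ sP [[tsub tQ tI tU] tadd tscale tconv]; split.
- split.
  + by move=> _ [V tV <-] x [].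
  + by exists Q => //; rewrite setIidr.
  + move=> _ _ [U tU' <-] [V tV <-]; exists (U `&` V); first exact: tI.
    by rewrite setIIl.
  (* Taking every open set whose trace lies in [F] avoids choosing one for each member of [F]. *)
  + move=> F Ft; exists (\bigcup_(V in [set V | tau V /\ F (V `&` P)]) V).
      by apply: tU => V [].
    rewrite setI_bigcupl; apply/seteqP; split=> x.
      by move=> [V [tV FV] VPx]; exists (V `&` P).
    by move=> [U FU Ux]; have [V tV VU] := Ft _ FU; exists V; [split; rewrite ?VU|rewrite VU].
- move=> x y _ Px Py [U tU' <-] [Uxy _].
  have [V [W [tV tW Vx Wy VWU]]] := tadd x y U (PQ _ Px) (PQ _ Py) tU' Uxy.
  exists (V `&` P), (W `&` P); split=> //; [by exists V|by exists W|].
  by move=> v z [Vv Pv] [Wz Pz]; split; [exact: VWU|exact: subspaceD].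
- move=> a x _ Px [U tU' <-] [Uax _].
  have [e [V [e0 tV Vx VU]]] := tscale a x U (PQ _ Px) tU' Uax.
  exists e, (V `&` P); split=> //; first by exists V.
  by move=> b v be [Vv Pv]; split; [exact: VU|exact: subspaceZ].
- move=> x _ [U tU' <-] [Ux Px].
  have [V [tV Vx VU cV]] := tconv x U tU' Ux.
  exists (V `&` P); split=> //; first by exists V.
    exact: setSI.
  exact: convex_setI_subspace.
Qed.

(* The restriction of a locally convex topology is locally convex only on a linear
   subspace; when the two unions coincide, nothing has to be restricted. *)
Lemma ind_lim_cont (I J : Type) (X : I -> @topsub K E) (Y : J -> @topsub K E) :
  (forall i, exists j, cont_incl (X i) (Y j)) ->
  subspace (carrier (ind_lim X)) \/ carrier (ind_lim X) = carrier (ind_lim Y) ->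
  cont_incl (ind_lim X) (ind_lim Y).
Proof.
move=> XY sP; have PQ : carrier (ind_lim X) `<=` carrier (ind_lim Y).
  move=> f /= [i _ Xf]; have [j [h _]] := XY i.
  by exists j => //; exact: h.
have lcP tau : lc_topology (carrier (ind_lim Y)) tau ->
    lc_topology (carrier (ind_lim X)) [set V `&` carrier (ind_lim X) | V in tau].
  case: sP => [sP|->] lct; first exact: lc_topology_subspace lct.
  rewrite (_ : [set _ | _ in _] = tau)//; apply/seteqP.
  have [[tsub _ _ _] _ _ _] := lct.
  split=> [_ [V tV <-]|V tV]; first by rewrite setIidl//; exact: tsub.
  by exists V => //; rewrite setIidl//; exact: tsub.
split=> //; apply: smallest_topology_cont => // V [sigma [lcs cs sV]].
split; first by case: lcs => -[+ _ _ _] _ _ _; exact.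
(* The trace of [sigma] is one of the locally convex topologies whose supremum is the topology of
   [ind_lim X]. *)
move=> tau _; apply; exists [set V `&` carrier (ind_lim X) | V in sigma].
split; [exact: lcP| |by exists V].
move=> i _ [W sW <-]; have [j [Xi op]] := XY i.
rewrite (_ : _ `&` _ = W `&` carrier (Y j) `&` carrier (X i)).
  by apply: op; exact: cs.
apply/seteqP; split=> x [].
- by case=> Wx _ Xx; split=> //; split=> //; exact: Xi.
- by case=> Wx _ Xx; split=> //; split=> //; exists i.
Qed.

Lemma normed_sub_cont (R : realType) (P Q : set E) (r s : E -> \bar R) (C : R) :
  0 < C -> P `<=` Q ->
  (forall f g (rho : R), P f -> P g -> 0 < rho -> (r (g - f)%R <= rho%:E)%E ->
     (s (g - f)%R <= (C * rho)%:E)%E) ->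
  cont_incl (normed_sub P r) (normed_sub Q s).
Proof.
move=> C0 PQ rs; split=> // V [VQ Vop]; split=> [|f [Vf Pf]]; first by move=> x [].
have [e e0 eV] := Vop f Vf.
(* The norm estimate is a weak inequality and balls are open; the factor 2 restores strictness. *)
exists (e / (2 * C)) => [|g Pg rge]; first by rewrite divr_gt0// mulr_gt0.
split=> //; apply: eV; first exact: PQ.
have := rs f g (e / (2 * C)) Pf Pg; rewrite divr_gt0 ?mulr_gt0// => /(_ isT (ltW rge)).
move=> /le_lt_trans; apply; rewrite lte_fin.
have -> : C * (e / (2 * C)) = e / 2 by field; rewrite gt_eqF.
by rewrite ltr_pdivrMr// ltr_pMr// ltr1n.
Qed.

Lemma cont_incl_anti X Y : cont_incl X Y -> cont_incl Y X ->
  (forall V, opens X V -> V `<=` carrier X) ->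
  (forall V, opens Y V -> V `<=` carrier Y) ->
  carrier X = carrier Y /\ opens X = opens Y.
Proof.
move=> [XY oXY] [YX oYX] sX sY.
have e : carrier X = carrier Y by apply/seteqP; split.
split=> //; apply/seteqP; split=> V oV.
- by have := oYX _ oV; rewrite -e setIidl//; exact: sX.
- by have := oXY _ oV; rewrite e setIidl//; exact: sY.
Qed.

End LimitComparison.

(** u + v is at most twice the larger of the two. This crude bound stands in for Minkowski's
    inequality where only finiteness of the L^p norms matters. *)
Lemma powR_add_le {R : realType} (u v p : R) : 0 <= p -> 0 <= u -> 0 <= v ->
  (u + v) `^ p <= (2 * u) `^ p + (2 * v) `^ p.
Proof.
move=> p0 u0 v0; wlog uv : u v u0 v0 / u <= v.
  move=> H; have [uv|/ltW vu] := leP u v; first exact: H.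
  by rewrite (addrC u) (addrC ((2 * u) `^ p)); exact: H.
apply: (@le_trans _ _ ((2 * v) `^ p)); last by rewrite lerDr powR_ge0.
by rewrite ge0_ler_powR ?nnegrE ?addr_ge0 ?mulr_ge0//; lra.
Qed.

Lemma ltey_bound {R : realType} (x : \bar R) : (x < +oo)%E ->
  exists2 rho : R, 0 < rho & (x <= rho%:E)%E.
Proof.
case: x => [r _|//|_]; last by exists 1; rewrite ?leNye.
by exists (`|r| + 1); rewrite ?ltr_wpDl// lee_fin (le_trans (ler_norm r))// lerDl.
Qed.

(** * Linearity of the unions over n *)

Section Subspaces.
Context {R : realType} {N : nat} (w : R -> R) (p : R).
Hypothesis Hw : nonquasianalytic_weight w.
Hypothesis p1 : 1 <= p.
Local Notation E := 'rV[R]_N.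
Implicit Types (m : nat) (n : int) (f g : E -> R[i]) (z : R[i]).

Lemma expweight_anti (n n' : int) (x : E) : n <= n' ->
  expR (- (n'%:~R * w (enorm x))) <= expR (- (n%:~R * w (enorm x))).
Proof.
move=> nn'; rewrite ler_expR lerN2 ler_wpM2r ?ler_int//.
by apply: (weight_ge0 Hw); exact: enorm_ge0.
Qed.

(** Two elements of an inductive limit may come from different steps; since exp (- n w) decreases in
    [n], both are compared at a common larger index. *)
Lemma weighted_partial_lin n n1 n2 a z f g x : n1 <= n -> n2 <= n ->
  smooth f -> smooth g ->
  weighted_partial w n a (z *: f + g) x <=
  modulus z * weighted_partial w n1 a f x + weighted_partial w n2 a g x.
Proof.
move=> n1n n2n sf sg; rewrite /weighted_partial mpartial_lin//.
apply: (@le_trans _ _ (expR (- (n%:~R * w (enorm x))) *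
    (modulus z * modulus (mpartial a f x) + modulus (mpartial a g x)))).
  by rewrite ler_wpM2l ?expR_ge0//; exact: modulus_lin.
rewrite mulrDr lerD//; last by rewrite ler_wpM2r ?modulus_ge0// expweight_anti.
by rewrite mulrCA ler_wpM2l ?modulus_ge0// ler_wpM2r ?modulus_ge0// expweight_anti.
Qed.

Lemma rnorm_lin m n n1 n2 z f g (r s : R) : (0 < m)%N -> n1 <= n -> n2 <= n ->
  0 <= r -> 0 <= s -> smooth f -> smooth g ->
  (rnorm w m n1 f <= r%:E)%E -> (rnorm w m n2 g <= s%:E)%E ->
  (rnorm w m n (z *: f + g)%R <= (modulus z * r + s)%:E)%E.
Proof.
move=> m0 n1n n2n r0 s0 sf sg fr gs.
apply: (rnorm_le Hw) => // [|a x y ya].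
  by rewrite addr_ge0// mulr_ge0// modulus_ge0.
have hf := rnorm_term x fr ya; have hg := rnorm_term x gs ya.
have := weighted_partial_lin a z x n1n n2n sf sg.
rewrite /weighted_partial => h.
rewrite expRD mulrA (mulrC (modulus _)).
apply: (le_trans (ler_wpM2r (expR_ge0 _) h)); rewrite mulrDl lerD//.
  rewrite -mulrA ler_wpM2l ?modulus_ge0//; apply: le_trans hf.
  by rewrite expRD mulrA (mulrC (modulus _)).
by apply: le_trans hg; rewrite expRD mulrA (mulrC (modulus _)).
Qed.

Lemma pintegral_lin n n1 n2 a z f g : n1 <= n -> n2 <= n -> smooth f -> smooth g ->
  (pintegral w p n a (z *: f + g)%R <= ((2 * modulus z) `^ p)%:E * pintegral w p n1 a f
     + (2 `^ p)%:E * pintegral w p n2 a g)%E.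
Proof.
move=> n1n n2n sf sg; have p0 : 0 <= p := le_trans ler01 p1.
have mf := measurable_weighted_powR p Hw n1 a sf.
have mg := measurable_weighted_powR p Hw n2 a sg.
rewrite /pintegral -!ge0_integralZl_EFin ?powR_ge0//; last 2 first.
- by move=> t _; rewrite lee_fin powR_ge0.
- by move=> t _; rewrite lee_fin powR_ge0.
rewrite -ge0_integralD//; last 4 first.
- by move=> t _; rewrite -EFinM lee_fin mulr_ge0 ?powR_ge0.
- exact: measurable_funeM.
- by move=> t _; rewrite -EFinM lee_fin mulr_ge0 ?powR_ge0.
- exact: measurable_funeM.
apply: ge0_le_integral => //.
- by move=> t _; rewrite lee_fin powR_ge0.
- exact: (measurable_weighted_powR p Hw n a (smooth_lin z sf sg)).
- by apply: emeasurable_funD; exact: measurable_funeM.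
move=> t _; rewrite -!EFinM -EFinD lee_fin.
have f0 := weighted_partial_ge0 w n1 a f (row_of t).
have g0 := weighted_partial_ge0 w n2 a g (row_of t).
rewrite -!powRM ?mulr_ge0 ?modulus_ge0// -mulrA.
apply: le_trans (powR_add_le p0 _ g0); last by rewrite mulr_ge0 ?modulus_ge0.
rewrite ge0_ler_powR ?nnegrE ?weighted_partial_ge0 ?addr_ge0 ?mulr_ge0 ?modulus_ge0//.
exact: weighted_partial_lin.
Qed.

Lemma rpsum_lin m n n1 n2 z f g (r s : R) : n1 <= n -> n2 <= n ->
  smooth f -> smooth g ->
  (rpsum w p m n1 f <= r%:E)%E -> (rpsum w p m n2 g <= s%:E)%E ->
  (rpsum w p m n (z *: f + g)%R <= ((2 * modulus z) `^ p * r + 2 `^ p * s)%:E)%E.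
Proof.
move=> n1n n2n sf sg fr gs; apply: ge_ereal_sup => _ [A [fA _] <-].
pose T (n' : int) (h : E -> R[i]) a :=
  (pintegral w p n' a h * expeR (- (p%:E * young_term w m a)))%E.
have T0 n' h a : (0 <= T n' h a)%E by exact: rpsum_term_ge0.
have sub n' h : (\sum_(a \in A) T n' h a <= rpsum w p m n' h)%E.
  by apply: ereal_sup_ubound; exists A.
apply: (@le_trans _ _ (((2 * modulus z) `^ p)%:E * (\sum_(a \in A) T n1 f a) +
    (2 `^ p)%:E * (\sum_(a \in A) T n2 g a))%E).
  rewrite !ge0_mule_fsumr// -fsbig_split//=.
  apply: lee_fsum => // a _.
  rewrite /T !muleA -ge0_muleDl ?mule_ge0 ?lee_fin ?powR_ge0 ?pintegral_ge0//.
  by rewrite lee_wpmul2r ?expeR_ge0// pintegral_lin.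
rewrite EFinD !EFinM leeD// lee_wpmul2l ?lee_fin ?powR_ge0//.
- exact: le_trans (sub _ _) fr.
- exact: le_trans (sub _ _) gs.
Qed.

Lemma subspace_ind_Omn m :
  subspace (carrier (ind_lim (fun n : nat => Omn N w m.+1 n.+1))).
Proof.
move=> z f g [n1 _ [sf /ltey_bound[r r0 fr]]] [n2 _ [sg /ltey_bound[s s0 gs]]].
exists (maxn n1 n2); first by [].
split; first exact: smooth_lin.
apply: (le_lt_trans _ (ltry (modulus z * r + s))).
by apply: (rnorm_lin _ _ _ _ (ltW r0) (ltW s0) sf sg fr gs) => //;
  rewrite lez_nat ltnS ?leq_maxl ?leq_maxr.
Qed.

Lemma subspace_ind_Omnp m :
  subspace (carrier (ind_lim (fun n : nat => Omnp N w p m.+1 n.+1))).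
Proof.
have p0 : 0 <= p := le_trans ler01 p1.
have pn0 : p^-1 != 0 by rewrite invr_eq0 gt_eqF// (lt_le_trans ltr01).
move=> z f g [n1 _ [sf fr]] [n2 _ [sg gs]].
rewrite !rpnormE// in fr gs.
have [r r0 {}fr] := ltey_bound (lty_poweRy pn0 fr).
have [s s0 {}gs] := ltey_bound (lty_poweRy pn0 gs).
exists (maxn n1 n2); first by [].
split; first exact: smooth_lin.
rewrite rpnormE//; apply: poweR_lty; apply: le_lt_trans (ltry _).
by apply: (rpsum_lin _ _ _ _ _ fr gs) => //;
  rewrite lez_nat ltnS ?leq_maxl ?leq_maxr.
Qed.

End Subspaces.

(** * Inclusions between the steps, and the theorem *)

Section Comparison.
Context {R : realType} {N : nat} (w : R -> R) (p : R).
Hypothesis Hw : nonquasianalytic_weight w.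
Hypothesis p1 : 1 <= p.

(** The order of quantifiers serves both limits: [O_C] needs the new [n] to be independent of [m],
    [O_M] needs [m'] to be independent of [n]. *)
Lemma Omn_incl_Omnp : exists k : nat, forall m : nat, exists m' : nat, forall n : nat,
  cont_incl (Omn N w m'.+1 n.+1) (Omnp N w p m.+1 (n + k).+1).
Proof.
have [k [l l0 h]] := rpnorm_le_rnorm (N := N) Hw p1.
exists k => m; have [C C0 hC] := h m.+1 isT.
exists (m.+1 * l).-1 => n; rewrite prednK ?muln_gt0//.
have nk : ((n + k).+1)%:Z = n.+1%:Z + k%:Z by rewrite -PoszD addSn.
apply: (normed_sub_cont C0) => [f [sf]|f g rho [sf _] [sg _] rho0 fg].
  move=> /ltey_bound[rho rho0 frho]; split=> //.
  by rewrite nk; apply: le_lt_trans (hC _ _ _ rho0 sf frho) (ltry _).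
by rewrite nk; exact: (hC _ _ _ rho0 (smoothB sf sg) fg).
Qed.

Lemma Omnp_incl_Omn : exists v : nat -> nat, forall m : nat, exists m' : nat,
  forall n : nat, cont_incl (Omnp N w p m'.+1 n.+1) (Omn N w m.+1 (v n).+1).
Proof.
have [k k0 h] := rnorm_le_rpnorm (N := N) Hw p1.
(* The actual index n + 1 is multiplied by [k]; the predecessor undoes the successor in the
   statement. *)
exists (fun n => (k * n.+1).-1) => m; have [q hq] := h m.+1 isT.
exists (m + q)%N => n; rewrite prednK ?muln_gt0 ?k0//.
have [C C0 hC] := hq n.+1; rewrite addSn in hC.
apply: (normed_sub_cont C0) => [f [sf]|f g rho [sf _] [sg _] rho0 fg].
  move=> /ltey_bound[rho rho0 frho]; split=> //.
  by apply: le_lt_trans (hC _ _ rho0 sf frho) (ltry _).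
exact: (hC _ _ rho0 (smoothB sf sg) fg).
Qed.

End Comparison.

Theorem proposition3p14 (R : realType) (N : nat) (w : R -> R) (p : R) :
  (0 < N)%N -> nonquasianalytic_weight w -> 1 <= p ->
  (carrier (O_M N w) = carrier (O_Mp N w p) /\
   opens (O_M N w) = opens (O_Mp N w p)) /\
  (carrier (O_C N w) = carrier (O_Cp N w p) /\
   opens (O_C N w) = opens (O_Cp N w p)).
Proof.
move=> _ Hw p1.
have [k hA] := Omn_incl_Omnp (N := N) Hw p1.
have [v hB] := Omnp_incl_Omn (N := N) Hw p1.
split.
  apply: cont_incl_anti; [| |exact: proj_lim_opens_sub|exact: proj_lim_opens_sub].
  - apply: proj_lim_cont => m; have [m' hm] := hA m; exists m'.
    (* At the fixed levels [m'] and [m] the two unions need not be equal, so linearity is used. *)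
    apply: ind_lim_cont; last by left; exact: subspace_ind_Omn.
    by move=> n; exists (n + k)%N; exact: hm.
  - apply: proj_lim_cont => m; have [m' hm] := hB m; exists m'.
    apply: ind_lim_cont; last by left; exact: subspace_ind_Omnp.
    by move=> n; exists (v n); exact: hm.
pose X n := proj_lim (fun m : nat => Omn N w m.+1 (Posz n.+1)).
pose Y n := proj_lim (fun m : nat => Omnp N w p m.+1 (Posz n.+1)).
have XY n : exists n', cont_incl (X n) (Y n').
  exists (n + k)%N; apply: proj_lim_cont => m.
  by have [m' hm] := hA m; exists m'; exact: hm.
have YX n : exists n', cont_incl (Y n) (X n').
  exists (v n); apply: proj_lim_cont => m.
  by have [m' hm] := hB m; exists m'; exact: hm.
(* Here the unions are compared after intersecting over all [m], and the inclusions in both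
   directions make them equal. *)
have XYe : carrier (ind_lim X) = carrier (ind_lim Y).
  apply/seteqP; split=> f [n _ fn].
  - by have [n' [h _]] := XY n; exists n' => //; exact: h.
  - by have [n' [h _]] := YX n; exists n' => //; exact: h.
apply: (@cont_incl_anti _ _ (ind_lim X) (ind_lim Y));
  [| |exact: ind_lim_opens_sub|exact: ind_lim_opens_sub].
- by apply: ind_lim_cont => //; right.
- by apply: ind_lim_cont => //; right.
Qed.
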